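(* Let $\theta\in\mathbb Z$, $0\le r_1<1<r_2\le\infty$, let $\alpha_+(t)=\sum_{k\ge 0}\alpha_k t^k$ be analytic in $|t|<r_2$ and $\beta_-(t)=\sum_{k\le -1}\beta_k t^k$ be analytic in $|t|>r_1$ (vanishing at $\infty$), and let $$a(t)=\begin{pmatrix}1&\beta_-(t)\\ \alpha_+(t)& t^\theta+\alpha_+(t)\beta_-(t)\end{pmatrix}.$$ For $N\in\mathbb N$ let $a_N(t)$ be the Laurent matrix polynomial obtained from $a(t)$ by replacing $\alpha_+$ by $\alpha_+^{(N)}(t)=\sum_{k=0}^N\alpha_kt^k$ and $\beta_-$ by $\beta_-^{(N)}(t)=\sum_{k=-N}^{-1}\beta_kt^k$. Suppose that $a(t)$ admits a stable factorisation $a(t)=a_-(t)d_r(t)a_+(t)$, $t\in\mathbb T$, and that this factorisation is $P$-normalised, where $P\in\{I_2,J_2\}$. Then there exists a natural number $N_0$ such that, for $N>N_0$ and for all admissible pairs $(\zeta_1,\zeta_2)$, the following two conditions are fulfilled: 1. $a_N(t)$ admits a stable $P$-normalised factorisation $a_N(t)=a_-^{(N)}(t)d_r(t)a_+^{(N)}(t)$ (with the same $P$ and the same diagonal factor $d_r$); 2. $q_N(\zeta_1,\zeta_2)<1$, where $$q_N(\zeta_1,\zeta_2)=\sigma\,\delta_N(\zeta_1,\zeta_2)\,\bigl\|\bigl(a_+^{(N)}\bigr)^{-1}\bigr\|_W\,\bigl\|\bigl(a_-^{(N)}\bigr)^{-1}\bigr\|_W .$$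
   Context: Wiener algebra. $W^{p\times p}$ is the algebra of $p\times p$ matrix functions $A(t)=\sum_{k\in\mathbb Z}A_kt^k$ on the unit circle $\mathbb T$ with $\|A\|_W=\sum_k\|A_k\|_1<\infty$, where $\|\cdot\|_1$ is the maximum column sum matrix norm. $W_+^{p\times p}$ (resp. $W_-^{p\times p}$) is the subalgebra of those with $A_k=0$ for $k<0$ (resp. $k>0$). Factorisation. A (right Wiener–Hopf) factorisation of an invertible $a\in W^{2\times2}$ is $a(t)=a_-(t)d_r(t)a_+(t)$, $t\in\mathbb T$, where $a_\pm\in W_\pm^{2\times2}$ is invertible in $W_\pm^{2\times 2}$ and $d_r(t)=\mathrm{diag}[t^{\rho_1},t^{\rho_2}]$ with integers $\rho_1\le\rho_2$ (the right partial indices, uniquely determined by $a$). The factorisation is stable if $\rho_2-\rho_1\le 1$. For the matrix functions $a$ and $a_N$ here the determinant is $t^\theta$, so $\rho_1+\rho_2=\theta$, and stability means: $\rho_1=\rho_2=\nu$ if $\theta=2\nu$; $\rho_1=\nu,\ \rho_2=\nu+1$ if $\theta=2\nu+1$. $P$-normalisation of a stable factorisation. Let $I_2$ be the unit matrix and $J_2=\begin{pmatrix}0&1\\1&0\end{pmatrix}$. If $\rho_1=\rho_2$, normalised means $a_-(\infty)=I_2$. If $\rho_2=\rho_1+1$, write $a_-(t)=C_0+C_1t^{-1}+\cdots$; the factorisation is $I_2$-normalised if $C_0$ is lower triangular with unit diagonal and $(C_1)_{12}=0$; it is $J_2$-normalised if $J_2C_0$ is lower triangular with unit diagonal and $(J_2C_1)_{12}=0$.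 A $P$-normalised factorisation, when it exists, is unique. Admissible pairs and $\delta_N$. A pair $(\zeta_1,\zeta_2)$ is admissible if $r_1<\zeta_1<1$ and $1<\zeta_2<r_2$; in addition $\zeta_1=r_1$ is allowed if $r_1>0$ and $\beta_-$ extends continuously to $|t|=r_1$, and $\zeta_2=r_2$ is allowed if $r_2<\infty$ and $\alpha_+$ extends continuously to $|t|=r_2$. Put $M_+(\zeta_2)=\max_{|t|=\zeta_2}|\alpha_+(t)|$, $M_-(\zeta_1)=\max_{|t|=\zeta_1}|\beta_-(t)|$ and $$\delta_N(\zeta_1,\zeta_2)=\Bigl(1+\frac{\zeta_2M_+(\zeta_2)}{\zeta_2-1}\Bigr)\frac{\zeta_1^{N+1}M_-(\zeta_1)}{1-\zeta_1}+\Bigl(1+\frac{\zeta_1M_-(\zeta_1)}{1-\zeta_1}\Bigr)\frac{M_+(\zeta_2)}{\zeta_2^N(\zeta_2-1)}.$$ Constant $\sigma$: $\sigma=\|d_r\|_W=\|d_r^{-1}\|_W$, i.e. $\sigma=1$ if $\theta$ is even and $\sigma=2$ if $\theta$ is odd.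
   Formalization: Condition 1 holds for all N > N_0 with one N_0, but in condition 2 the threshold for N may depend on the admissible pair; a single N_0 for all pairs fails, e.g. θ=0, α_+=0, β_-=1/t gives q_N=2ζ_1^N/(1-ζ_1), unbounded as ζ_1→1. *)

(* Defs.v *)
From HB Require Import structures.
From mathcomp Require Import all_boot all_order all_algebra.
From mathcomp Require Import all_classical all_reals all_analysis.
From mathcomp Require Import complex.

Set Implicit Arguments.
Unset Strict Implicit.
Unset Printing Implicit Defensive.

Import Order.TTheory GRing.Theory Num.Theory.
Import numFieldNormedType.Exports.

Local Open Scope classical_set_scope.
Local Open Scope ring_scope.

(* In MathComp the norm `|z| of z : R[i] is an element of R[i]; cabs z is the
   modulus as an element of R. *)
Definition cabs (R : realType) (z : R[i]) : R := ComplexField.Normc.normc z.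

(* The topology used on the complex numbers is that of the normed module
   R[i]^o, whence the casts below. *)

(* An element of the Wiener algebra is represented by its family of Fourier
   coefficients A : int -> 'M_p. Algebraic relations between elements are
   stated pointwise on the unit circle, through weval. *)

Definition norm1 (R : realType) (p : nat) (M : 'M[R[i]]_p) : R :=
  \big[Num.max/0]_(j < p) \sum_(i < p) cabs (M i j).

Definition wnorm (R : realType) (p : nat) (A : int -> 'M[R[i]]_p) : \bar R :=
  \esum_(k in [set: int]) (norm1 (A k))%:E.

Definition in_W (R : realType) (p : nat) (A : int -> 'M[R[i]]_p) : Prop :=
  (wnorm A < +oo)%E.

Definition in_Wplus (R : realType) (p : nat) (A : int -> 'M[R[i]]_p) : Prop :=
  in_W A /\ forall k : int, k < 0 -> A k = 0.

Definition in_Wminus (R : realType) (p : nat) (A : int -> 'M[R[i]]_p) : Prop :=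
  in_W A /\ forall k : int, 0 < k -> A k = 0.

(* The value at t of the sum over k in Z of A_k t^k, as the entrywise limit of
   the symmetric partial sums over -n <= k <= n. *)
Definition weval (R : realType) (p : nat) (A : int -> 'M[R[i]]_p) (t : R[i]) :
    'M[R[i]]_p :=
  \matrix_(i, j) limn (fun n : nat =>
    \sum_(m < n.*2.+1) A (m%:Z - n%:Z) i j * t ^ (m%:Z - n%:Z) : R[i]^o).

Definition is_winv (R : realType) (p : nat) (A B : int -> 'M[R[i]]_p) : Prop :=
  in_W B /\ forall t : R[i], cabs t = 1 -> weval A t *m weval B t = 1%:M.

(* The inverse of A in the Wiener algebra; 0 if A is not invertible. *)
Definition winv (R : realType) (p : nat) (A : int -> 'M[R[i]]_p) :
    int -> 'M[R[i]]_p :=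
  xget (fun=> 0) [set B | is_winv A B].

Definition unit_Wplus (R : realType) (p : nat) (A : int -> 'M[R[i]]_p) : Prop :=
  in_Wplus A /\ exists B, in_Wplus B /\ is_winv A B.

Definition unit_Wminus (R : realType) (p : nat) (A : int -> 'M[R[i]]_p) : Prop :=
  in_Wminus A /\ exists B, in_Wminus B /\ is_winv A B.

Definition mx2 (K : Type) (a b c d : K) : 'M[K]_2 :=
  \matrix_(i, j) if i == ord0 then (if j == ord0 then a else b)
                 else (if j == ord0 then c else d).

Definition J2 (R : realType) : 'M[R[i]]_2 := mx2 0 1 1 0.

Definition d_r (R : realType) (rho1 rho2 : int) (t : R[i]) : 'M[R[i]]_2 :=
  mx2 (t ^ rho1) 0 0 (t ^ rho2).

Definition factorisation (R : realType) (a : R[i] -> 'M[R[i]]_2)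
    (am : int -> 'M[R[i]]_2) (rho1 rho2 : int) (ap : int -> 'M[R[i]]_2) : Prop :=
  [/\ rho1 <= rho2,
      unit_Wminus am,
      unit_Wplus ap
    & forall t : R[i], cabs t = 1 ->
        a t = weval am t *m d_r rho1 rho2 t *m weval ap t].

Definition stable (rho1 rho2 : int) : Prop := rho2 - rho1 <= 1.

Definition unit_lower_triangular (R : realType) (M : 'M[R[i]]_2) : Prop :=
  is_trig_mx M /\ forall i, M i i = 1.

(* a_-(t) = C_0 + C_1 t^-1 + ... has C_k = am (- k); the clause for unequal
   indices is meant for rho2 = rho1 + 1. *)
Definition normalised (R : realType) (P : 'M[R[i]]_2) (rho1 rho2 : int)
    (am : int -> 'M[R[i]]_2) : Prop :=
  if rho1 == rho2 then am 0 = 1%:M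
  else unit_lower_triangular (P *m am 0) /\
       (P *m am (- 1)) ord0 (lift ord0 ord0) = 0.

Definition stable_normalised_factorisation (R : realType)
    (P : 'M[R[i]]_2) (a : R[i] -> 'M[R[i]]_2) (am : int -> 'M[R[i]]_2)
    (rho1 rho2 : int) (ap : int -> 'M[R[i]]_2) : Prop :=
  [/\ factorisation a am rho1 rho2 ap,
      stable rho1 rho2
    & normalised P rho1 rho2 am].

Definition a_mx (R : realType) (theta : int) (alphap betam : R[i] -> R[i])
    (t : R[i]) : 'M[R[i]]_2 :=
  mx2 1 (betam t) (alphap t) (t ^ theta + alphap t * betam t).

Definition alpha_trunc (R : realType) (alpha : nat -> R[i]) (N : nat)
    (t : R[i]) : R[i] :=
  \sum_(0 <= k < N.+1) alpha k * t ^+ k.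

(* beta k stands for the coefficient of t^-k, k >= 1; beta 0 is not used. *)
Definition beta_trunc (R : realType) (beta : nat -> R[i]) (N : nat)
    (t : R[i]) : R[i] :=
  \sum_(1 <= k < N.+1) beta k * t ^- k.

(* alphap is analytic in |t| < r2 with Taylor coefficients alpha. *)
Definition analytic_inside (R : realType) (r2 : \bar R) (alpha : nat -> R[i])
    (alphap : R[i] -> R[i]) : Prop :=
  forall t : R[i], ((cabs t)%:E < r2)%E ->
    (fun N => alpha_trunc alpha N t : R[i]^o) @ \oo --> (alphap t : R[i]^o).

(* betam is analytic in |t| > r1, infinity included, vanishes at infinity and
   has Laurent coefficients beta. *)
Definition analytic_outside (R : realType) (r1 : R) (beta : nat -> R[i])
    (betam : R[i] -> R[i]) : Prop :=
  forall t : R[i], r1 < cabs t ->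
    (fun N => beta_trunc beta N t : R[i]^o) @ \oo --> (betam t : R[i]^o).

Definition a_N (R : realType) (theta : int) (alpha beta : nat -> R[i])
    (N : nat) : R[i] -> 'M[R[i]]_2 :=
  a_mx theta (alpha_trunc alpha N) (beta_trunc beta N).

Definition cont_extension (R : realType) (D E : set R[i]) (f g : R[i] -> R[i]) :
    Prop :=
  (forall t, D t -> g t = f t) /\ {within (E : set R[i]^o), continuous (g : R[i]^o -> R[i]^o)}.

(* The values of a function outside its domain of analyticity are meaningless;
   extend D E f replaces f by a continuous extension from D to E if there is
   one, and is f otherwise. *)
Definition extend (R : realType) (D E : set R[i]) (f : R[i] -> R[i]) :
    R[i] -> R[i] :=
  xget f [set g | cont_extension D E f g].

Definition disc (R : realType) (r : \bar R) : set R[i] :=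
  [set t | ((cabs t)%:E < r)%E].
Definition cdisc (R : realType) (r : \bar R) : set R[i] :=
  [set t | ((cabs t)%:E <= r)%E].
Definition ext_disc (R : realType) (r : R) : set R[i] := [set t | r < cabs t].
Definition ext_cdisc (R : realType) (r : R) : set R[i] := [set t | r <= cabs t].

Definition max_circle (R : realType) (f : R[i] -> R[i]) (z : R) : R :=
  sup [set cabs (f t) | t in [set t | cabs t = z]].

Definition M_plus (R : realType) (r2 : \bar R) (alphap : R[i] -> R[i])
    (z2 : R) : R :=
  max_circle (extend (disc r2) (cdisc r2) alphap) z2.

Definition M_minus (R : realType) (r1 : R) (betam : R[i] -> R[i])
    (z1 : R) : R :=
  max_circle (extend (ext_disc r1) (ext_cdisc r1) betam) z1.

Definition admissible (R : realType) (r1 : R) (r2 : \bar R)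
    (alphap betam : R[i] -> R[i]) (z1 z2 : R) : Prop :=
  (r1 < z1 < 1 \/
   [/\ z1 = r1, 0 < r1
     & exists g, cont_extension (ext_disc r1) (ext_cdisc r1) betam g]) /\
  (1 < z2 /\ (z2%:E < r2)%E \/
   z2%:E = r2 /\ exists g, cont_extension (disc r2) (cdisc r2) alphap g).

Definition delta_N (R : realType) (r1 : R) (r2 : \bar R)
    (alphap betam : R[i] -> R[i]) (N : nat) (z1 z2 : R) : R :=
  let Mp := M_plus r2 alphap z2 in
  let Mm := M_minus r1 betam z1 in
  (1 + z2 * Mp / (z2 - 1)) * (z1 ^+ N.+1 * Mm / (1 - z1)) +
  (1 + z1 * Mm / (1 - z1)) * (Mp / (z2 ^+ N * (z2 - 1))).

Definition sigma (R : realType) (theta : int) : R :=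
  if (2 %| theta)%Z then 1 else 2.

Definition q_N (R : realType) (theta : int) (r1 : R) (r2 : \bar R)
    (alphap betam : R[i] -> R[i]) (N : nat) (amN apN : int -> 'M[R[i]]_2)
    (z1 z2 : R) : \bar R :=
  ((sigma R theta * delta_N r1 r2 alphap betam N z1 z2)%:E
     * wnorm (winv apN) * wnorm (winv amN))%E.

(* Main.v *)
(* A stable factorisation survives small perturbations in the Wiener norm, and
   the truncations a_N converge to a in that norm.

   Let d = diag(t^rho_i), a = a_- d a_+ and let b be close to a.  Then
   a_-^-1 b a_+^-1 d^-1 = 1 + e with e small.  Split the coefficients of the
   (i, j) entry of a matrix at rho_i - rho_j: the upper parts form the algebra
   d W_+ d^-1, the lower ones lie in W_- because rho_2 - rho_1 <= 1.  A
   contraction argument gives 1 + e = (1 + x)(1 + y) with x a small lower part and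
   y a small upper part, so that b = (a_- (1 + x)) d (d^-1 (1 + y) d a_+), with
   inverse factors bounded independently of b.  The lower parts x are exactly
   those for which multiplication by 1 + x preserves the normalisation, whatever
   P is.  Since normalised factorisations are unique, every normalised
   factorisation of a_N has these bounded inverse factors, and q_N -> 0 because
   delta_N -> 0.

   Identities between elements of the Wiener algebra, such as the ring laws for
   convolution, are checked pointwise on the circle, which is legitimate because
   an absolutely convergent Fourier series determines its coefficients. *)

Require Import Defs.
From HB Require Import structures.
From mathcomp Require Import all_boot all_order all_algebra finmap.
From mathcomp Require Import all_classical all_reals all_analysis.
From mathcomp Require Import complex.
From mathcomp Require Import zify ring lra.

Set Implicit Arguments.
Unset Strict Implicit.
Unset Printing Implicit Defensive.

Import Order.TTheory GRing.Theory Num.Theory.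
Import numFieldNormedType.Exports.

Local Open Scope classical_set_scope.
Local Open Scope ring_scope.

(** * Complex modulus and sums of nonnegative terms *)

Section Modulus.
Variable R : realType.
Implicit Types x y z t : R[i].

Lemma normE z : `|z| = ((cabs z)%:C)%C. Proof. by []. Qed.

Lemma cabs_ge0 z : 0 <= cabs z.
Proof. by case: z => a b; rewrite /cabs /= sqrtr_ge0. Qed.

Lemma cabs0 : cabs (0 : R[i]) = 0. Proof. exact: ComplexField.Normc.normc0. Qed.

Lemma cabs1 : cabs (1 : R[i]) = 1. Proof. exact: ComplexField.Normc.normc1. Qed.

Lemma cabs0_eq0 z : cabs z = 0 -> z = 0.
Proof. exact: ComplexField.Normc.eq0_normc. Qed.

Lemma cabsM x y : cabs (x * y) = cabs x * cabs y.
Proof. exact: ComplexField.Normc.normcM. Qed.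

Lemma cabsV x : cabs x^-1 = (cabs x)^-1.
Proof. exact: ComplexField.Normc.normcV. Qed.

Lemma cabsD x y : cabs (x + y) <= cabs x + cabs y.
Proof. exact: le_normcD. Qed.

Lemma cabsN x : cabs (- x) = cabs x.
Proof. exact: normcN. Qed.

Lemma cabsX x n : cabs (x ^+ n) = cabs x ^+ n.
Proof. by elim: n => [|n IH]; rewrite ?expr0 ?cabs1// !exprS cabsM IH. Qed.

Lemma cabs_exprz t (k : int) : cabs (t ^ k) = cabs t ^ k.
Proof. by case: k => n; rewrite /exprz ?cabsV cabsX. Qed.

Lemma cabs_exprz1 t (k : int) : cabs t = 1 -> cabs (t ^ k) = 1.
Proof. by move=> t1; rewrite cabs_exprz t1 exp1rz. Qed.

Lemma cabs1_neq0 t : cabs t = 1 -> t != 0.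
Proof.
by move=> t1; apply/eqP => t0; move: t1; rewrite t0 cabs0 => /eqP; rewrite eq_sym oner_eq0.
Qed.

Lemma cabs_real (x : R) : cabs (x%:C)%C = `|x|.
Proof. by rewrite /cabs /= expr0n addr0 sqrtr_sqr. Qed.

Lemma normRe_le z : `|complex.Re z| <= cabs z.
Proof.
by case: z => a b; rewrite /cabs /= -sqrtr_sqr ler_wsqrtr// lerDl sqr_ge0.
Qed.

Lemma normIm_le z : `|complex.Im z| <= cabs z.
Proof.
by case: z => a b; rewrite /cabs /= -sqrtr_sqr ler_wsqrtr// lerDr sqr_ge0.
Qed.

Lemma cabs_leReIm z : cabs z <= `|complex.Re z| + `|complex.Im z|.
Proof.
case: z => a b; have -> : (a +i* b)%C = (a%:C)%C + (0 +i* b)%C.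
  by apply/eqP; rewrite eq_complex /= addr0 add0r !eqxx.
apply: le_trans (cabsD _ _) _; rewrite cabs_real /= !(addr0, add0r) lerD2l.
by rewrite /cabs /= expr0n add0r sqrtr_sqr.
Qed.

Lemma cvg_cabsP (u : nat -> R[i]) (l : R[i]) :
  ((fun n => u n : R[i]^o) @ \oo --> (l : R[i]^o)) <->
  (forall e : R, 0 < e -> \forall n \near \oo, cabs (l - u n) < e).
Proof.
split=> [/cvgrPdist_lt ul e e0|ul].
  have /ul : 0 < (e%:C)%C by rewrite ltcR.
  by apply: filterS => n; rewrite normE ltcR.
apply/cvgrPdist_lt => e e0.
have [er eI] : 0 < complex.Re e /\ complex.Im e = 0.
  by move: e0; case: (e) => a b; rewrite ltcE /= => /andP[/eqP].
have -> : e = ((complex.Re e)%:C)%C.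
  by case: e eI {e0 er} => a b /= ->.
by apply: filterS (ul _ er) => n; rewrite normE ltcR.
Qed.

Lemma limn_cabs (u : nat -> R[i]) (l : R[i]) :
  (forall e : R, 0 < e -> \forall n \near \oo, cabs (l - u n) < e) ->
  limn (fun n => u n : R[i]^o) = l.
Proof. by move=> /cvg_cabsP/cvg_lim; apply; exact: norm_hausdorff. Qed.

End Modulus.

(** * Unordered sums of nonnegative families over the integers *)

Section NonnegativeSums.
Variable R : realType.
Implicit Types g h : int -> \bar R.

Definition box (n : nat) : set int := [set k : int | (`|k| <= n)%N].

(** Indexed like the partial sums in [weval], so that an entry of [weval] is convertible to a
    [csum]. *)
Definition psum (V : nmodType) (f : int -> V) (n : nat) : V :=
  \sum_(m < n.*2.+1) f (m%:Z - n%:Z).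

Local Open Scope ereal_scope.

Lemma esum_subset (T : choiceType) (A B : set T) (a : T -> \bar R) :
  (forall i, 0 <= a i) -> A `<=` B ->
  \esum_(i in A) a i <= \esum_(i in B) a i.
Proof.
move=> a0 AB; rewrite esum_mkcond [leRHS]esum_mkcond; apply: le_esum => i _.
case: ifPn => [|_]; first by rewrite inE => /AB/mem_set ->.
by case: ifP.
Qed.

Lemma le_esum_term (T : choiceType) (a : T -> \bar R) i :
  (forall i, 0 <= a i) -> a i <= \esum_(j in [set: T]) a j.
Proof.
by move=> a0; rewrite -[leLHS](esum_set1 (a0 i)); exact: esum_subset.
Qed.

Lemma exchange_esum (S T : choiceType) (a : S -> T -> \bar R) (A : set S) (B : set T) :
  (forall i j, 0 <= a i j) ->
  \esum_(i in A) \esum_(j in B) a i j = \esum_(j in B) \esum_(i in A) a i j.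
Proof.
move=> a0; rewrite !esum_esum//.
rewrite (reindex_esum (B `*`` (fun=> A)) _ (fun x => (x.2, x.1)))//; split => //=.
- by move=> [i j] [/=].
- by move=> [i1 i2] [j1 j2] /= _ _ [] -> ->.
- by move=> [i j] [/= Ai Bj]; exists (j, i).
Qed.

Lemma le_esumZ (T : choiceType) (A : set T) (a : T -> \bar R) (c : \bar R) :
  0 <= c -> (forall i, 0 <= a i) ->
  \esum_(i in A) (c * a i) <= c * \esum_(i in A) a i.
Proof.
move=> c0 a0; apply: ge_ereal_sup => _ /= [X XA <-].
rewrite -ge0_mule_fsumr//; apply: lee_wpmul2l => //.
by apply: ereal_sup_ubound; exists X.
Qed.

Lemma psum_esum g n : (forall k, 0 <= g k) ->
  psum g n = \esum_(k in box n) g k.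
Proof.
move=> g0; rewrite (reindex_esum `I_(n.*2.+1) _ (fun m : nat => m%:Z - n%:Z)%R).
  rewrite esum_fset//.
  by rewrite /psum (fsbig_ord _ _ (fun m : nat => g (m%:Z - n%:Z)%R)).
have surj (k : int) : box n k ->
    [set (m%:Z - n%:Z)%R | m in `I_(n.*2.+1)] k.
  by rewrite /box /= => kn; exists (absz (k + n%:Z)%R) => /=; lia.
by split => [m /=|m1 m2 _ _ /=|//]; rewrite /box /=; lia.
Qed.

Lemma sub_box (X : set int) : finite_set X -> exists n, X `<=` box n.
Proof.
move=> fX; exists (\max_(k <- fset_set X) absz k)%N => k Xk /=.
have kX : k \in fset_set X by rewrite in_fset_set// inE.
exact: (@leq_bigmax_seq int (enum_fset (fset_set X)) xpredT absz k).
Qed.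

Lemma box_le n m : (n <= m)%N -> box n `<=` box m.
Proof. by move=> nm k /= /leq_trans; apply. Qed.

(** The sum is a supremum over finite sets. A finite set that comes within [e] of it lies in some
    box, and since the total is finite the complement of the box is isolated by subtraction. *)
Lemma esum_tail_cvg g (e : R) : (forall k, 0 <= g k) ->
  \esum_(k in [set: int]) g k < +oo -> (0 < e)%R ->
  \forall n \near \oo, \esum_(k in ~` box n) g k < e%:E.
Proof.
move=> g0 goo e0.
have gfin : \esum_(k in [set: int]) g k \is a fin_num.
  by rewrite ge0_fin_numE// esum_ge0.
have lt_e : \esum_(k in [set: int]) g k - e%:E < \esum_(k in [set: int]) g k.
  by rewrite lteBlDr// lteDl.
have [_ [X [fX _] <-] Xe] := ereal_sup_gt lt_e.
have [n0 Xn0] := sub_box fX.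
exists n0 => // n /= n0n.
have bfin : \esum_(k in box n) g k \is a fin_num.
  rewrite ge0_fin_numE ?esum_ge0//; apply: le_lt_trans goo.
  exact: esum_subset.
have Xb : \sum_(k \in X) g k <= \esum_(k in box n) g k.
  rewrite -esum_fset//; apply: esum_subset => //.
  exact: subset_trans (box_le n0n).
have := lt_le_trans Xe Xb.
rewrite lteBlDr// (esumID (box n))// setTI setTI.
by rewrite lteD2lE.
Qed.

End NonnegativeSums.

(** * Absolutely convergent sums over the integers *)

Section ComplexSums.
Variable R : realType.
Implicit Types f g : int -> R[i].

Definition csum f : R[i] := limn (fun n => psum f n : R[i]^o).

Definition l1 f : \bar R := \esum_(k in [set: int]) (cabs (f k))%:E.

Lemma cabsE_ge0 f (k : int) : (0 <= (cabs (f k))%:E)%E.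
Proof. by rewrite lee_fin cabs_ge0. Qed.
Hint Resolve cabsE_ge0 : core.

Lemma l1_ge0 f : (0 <= l1 f)%E. Proof. exact: esum_ge0. Qed.

Lemma le_l1 f g : (forall k, cabs (f k) <= cabs (g k)) -> (l1 f <= l1 g)%E.
Proof. by move=> fg; apply: le_esum => k _; rewrite lee_fin. Qed.

Lemma eq_l1 f g : (forall k, cabs (f k) = cabs (g k)) -> l1 f = l1 g.
Proof. by move=> fg; apply: eq_esum => k _; rewrite fg. Qed.

Lemma l1D f g : (l1 (fun k => f k + g k)%R <= l1 f + l1 g)%E.
Proof. by rewrite /l1 -esumD//; apply: le_esum => k _; rewrite -EFinD lee_fin cabsD. Qed.

Lemma l1Z (c : R[i]) f : (l1 (fun k => c * f k)%R <= (cabs c)%:E * l1 f)%E.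
Proof.
apply: le_trans (le_esumZ _ _ _); rewrite ?lee_fin ?cabs_ge0//.
by apply: le_esum => k _; rewrite cabsM.
Qed.

Lemma l1_shift f (m : int) : l1 (fun k => f (k + m))%R = l1 f.
Proof.
rewrite /l1 [RHS](reindex_esum [set: int] [set: int] (fun k : int => k + m))//.
split => // [i j _ _ /addIr//|k _]; exists (k - m) => //=; exact: subrK.
Qed.

Lemma le_cabs_l1 f k : ((cabs (f k))%:E <= l1 f)%E.
Proof. exact: (le_esum_term (a := fun k => (cabs (f k))%:E)). Qed.

Let rsum (g : int -> R) : R := fine (\esum_(k in [set: int]) (g k)%:E).

Lemma EFin_psum (g : int -> R) n : (psum g n)%:E = psum (fun k => (g k)%:E) n.
Proof. by rewrite /psum sumEFin. Qed.

Let rsum_cvg (g : int -> R) : (forall k, 0 <= g k) ->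
  (\esum_(k in [set: int]) (g k)%:E < +oo)%E ->
  forall e : R, 0 < e -> \forall n \near \oo, `|rsum g - psum g n| < e.
Proof.
move=> g0 goo e e0.
have ge0 k : (0 <= (g k)%:E)%E by rewrite lee_fin.
apply: filterS (esum_tail_cvg ge0 goo e0) => n tn.
have tfin : (\esum_(k in ~` box n) (g k)%:E)%E \is a fin_num.
  rewrite ge0_fin_numE ?esum_ge0//.
  exact: lt_trans tn (ltry _).
rewrite /rsum (esumID (box n))// !setTI -psum_esum// -EFin_psum.
rewrite fineD//= addrAC subrr add0r.
by rewrite ger0_norm ?fine_ge0 ?esum_ge0// -lte_fin fineK.
Qed.

(** [h] is summed as the difference of the nonnegative families [h + m] and [m]. This gives the
    limit without a Cauchy argument, through sums that do not depend on any order. *)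
Let rpart (h m : int -> R) := rsum (fun k => h k + m k) - rsum m.

Let rpart_cvg (h m : int -> R) : (forall k, `|h k| <= m k) ->
  (\esum_(k in [set: int]) (m k)%:E < +oo)%E ->
  forall e : R, 0 < e -> \forall n \near \oo, `|rpart h m - psum h n| < e.
Proof.
move=> hm moo e e0.
have m0 k : 0 <= m k by exact: le_trans (hm k).
have hm0 k : 0 <= h k + m k by move: (hm k); rewrite ler_norml; lra.
have hmoo : (\esum_(k in [set: int]) (h k + m k)%:E < +oo)%E.
  apply: (@le_lt_trans _ _ (\esum_(k in [set: int]) ((m k)%:E + (m k)%:E))%E).
    by apply: le_esum => k _; rewrite -EFinD lee_fin lerD2r (le_trans (ler_norm _)).
  by rewrite esumD ?lte_add_pinfty// => k _; rewrite lee_fin.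
have e2 : 0 < e / 2 by rewrite divr_gt0.
apply: filterS2 (rsum_cvg hm0 hmoo e2) (rsum_cvg m0 moo e2) => n.
have -> : psum (fun k => h k + m k) n = psum h n + psum m n.
  by rewrite /psum big_split.
by rewrite /rpart !ltr_norml; lra.
Qed.

Let Re_psum f n : complex.Re (psum f n) = psum (fun k => complex.Re (f k)) n.
Proof. by rewrite /psum raddf_sum. Qed.

Let Im_psum f n : complex.Im (psum f n) = psum (fun k => complex.Im (f k)) n.
Proof. by rewrite /psum raddf_sum. Qed.

Let clim f : R[i] := (rpart (fun k => complex.Re (f k)) (fun k => cabs (f k))
  +i* rpart (fun k => complex.Im (f k)) (fun k => cabs (f k)))%C.

Let clim_cvg f : (l1 f < +oo)%E ->
  forall e : R, 0 < e -> \forall n \near \oo, cabs (clim f - psum f n) < e.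
Proof.
move=> foo e e0.
have e2 : 0 < e / 2 by rewrite divr_gt0.
apply: filterS2 (rpart_cvg (fun k => normRe_le (f k)) foo e2)
  (rpart_cvg (fun k => normIm_le (f k)) foo e2) => n Re_lt Im_lt.
apply: le_lt_trans (cabs_leReIm _) _.
rewrite !raddfB /= Re_psum Im_psum [e]splitr.
exact: ltrD.
Qed.

Let csumE f : (l1 f < +oo)%E -> csum f = clim f.
Proof. by move=> foo; apply: limn_cabs; exact: clim_cvg. Qed.

Lemma csum_cvg f : (l1 f < +oo)%E ->
  forall e : R, 0 < e -> \forall n \near \oo, cabs (csum f - psum f n) < e.
Proof. by move=> foo; rewrite csumE//; exact: clim_cvg. Qed.

(** Symmetric partial sums are not preserved by a shift, but [clim] is built from unordered sums,
    which every bijection of the indices preserves. *)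
Lemma csum_shift f (m : int) : (l1 f < +oo)%E -> csum (fun k => f (k + m)) = csum f.
Proof.
move=> foo; rewrite !csumE ?l1_shift//.
have rsh (g : int -> R) : rsum (fun k => g (k + m)) = rsum g.
  rewrite /rsum [in RHS](reindex_esum [set: int] [set: int] (fun k : int => k + m))//.
  by split => // [i j _ _ /addIr//|k _]; exists (k - m) => //=; exact: subrK.
rewrite /clim /rpart (rsh (fun k => complex.Re (f k) + cabs (f k))).
by rewrite (rsh (fun k => complex.Im (f k) + cabs (f k))) (rsh (fun k => cabs (f k))).
Qed.

Lemma psumS (V : nmodType) (f : int -> V) n :
  psum f n.+1 = f (- n.+1%:Z) + psum f n + f n.+1%:Z.
Proof.
rewrite /psum doubleS big_ord_recl big_ord_recr /= addrA.
congr (f _ + _ + f _); [lia| |rewrite /bump; lia].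
by apply: eq_bigr => i _; congr f; rewrite /bump; lia.
Qed.

Lemma psum0 (V : nmodType) (f : int -> V) : psum f 0 = f 0.
Proof. by rewrite /psum big_ord1. Qed.

Lemma psumB_le f n N : (n <= N)%N ->
  cabs (psum f N - psum f n) <=
  psum (fun k => cabs (f k)) N - psum (fun k => cabs (f k)) n.
Proof.
move=> /subnK <-; elim: (N - n)%N => [|p IH]; first by rewrite !subrr cabs0.
rewrite addSn !psumS.
set a := f _; set b := f _; set s := psum f (p + n); set s' := psum _ (p + n).
have -> : a + s + b - psum f n = (a + (s - psum f n)) + b by ring.
apply: le_trans (cabsD _ _) _.
have := cabsD a (s - psum f n); move: IH; rewrite -/s -/s'; lra.
Qed.

(** The limit is close to some [psum f N] with N >= n, and [psumB_le] bounds [psum f N - psum f n]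
    by the moduli of terms outside the box. *)
Lemma csum_tail f n : (l1 f < +oo)%E ->
  ((cabs (csum f - psum f n))%:E <= \esum_(k in ~` box n) (cabs (f k))%:E)%E.
Proof.
move=> foo; apply/lee_addgt0Pr => e e0.
have [N [Nn]] : exists N, (n <= N)%N /\ cabs (csum f - psum f N) < e.
  have [N0 _ N0P] := csum_cvg foo e0.
  by exists (maxn n N0); rewrite leq_maxl; split => //; apply: N0P; rewrite /= leq_maxr.
move=> Ne.
have tl : ((psum (fun k => cabs (f k)) N - psum (fun k => cabs (f k)) n)%:E <=
    \esum_(k in ~` box n) (cabs (f k))%:E)%E.
  rewrite EFinB leeBlDr// !EFin_psum !psum_esum// addeC.
  have := @esumID R int (box n) [set: int] _ (fun k _ => cabsE_ge0 f k).
  by rewrite !setTI => <-; exact: esum_subset.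
apply: le_trans (leeD2r _ tl).
rewrite -EFinD lee_fin.
have -> : csum f - psum f n = (psum f N - psum f n) + (csum f - psum f N) by ring.
apply: le_trans (cabsD _ _) _; apply: lerD; last exact: ltW.
exact: psumB_le.
Qed.

Lemma cabs_csum f : ((cabs (csum f))%:E <= l1 f)%E.
Proof.
have [->|foo] := eqVneq (l1 f) +oo%E; first by rewrite leey.
have {}foo : (l1 f < +oo)%E by rewrite ltey.
have := csum_tail 0 foo; rewrite psum0 => t0.
rewrite /l1 (esumID (box 0))// !setTI -psum_esum// psum0.
apply: le_trans (leeD2l _ t0).
rewrite -EFinD lee_fin -{1}[csum f](subrK (f 0)) addrC; exact: cabsD.
Qed.

Lemma eq_csum f g : f =1 g -> csum f = csum g.
Proof. by move=> /funext ->. Qed.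

Lemma csumD f g : (l1 f < +oo)%E -> (l1 g < +oo)%E ->
  csum (fun k => f k + g k) = csum f + csum g.
Proof.
move=> foo goo; apply: limn_cabs => e e0.
have e2 : 0 < e / 2 by rewrite divr_gt0.
apply: filterS2 (csum_cvg foo e2) (csum_cvg goo e2) => n fn gn.
rewrite [psum _ _]big_split /= -/(psum f n) -/(psum g n) opprD addrACA [e]splitr.
by apply: le_lt_trans (cabsD _ _) _; exact: ltrD.
Qed.

Lemma csumZ (c : R[i]) f : (l1 f < +oo)%E -> csum (fun k => c * f k) = c * csum f.
Proof.
move=> foo; apply: limn_cabs => e e0.
have c1 : 0 < cabs c + 1 by rewrite ltr_wpDl// cabs_ge0.
have e2 : 0 < e / (cabs c + 1) by rewrite divr_gt0.
apply: filterS (csum_cvg foo e2) => n fn.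
have -> : psum (fun k => c * f k) n = c * psum f n by rewrite /psum mulr_sumr.
rewrite -mulrBr cabsM; apply: (@le_lt_trans _ _ ((cabs c + 1) * cabs (csum f - psum f n))).
  by rewrite ler_wpM2r ?cabs_ge0// lerDl.
by rewrite mulrC -ltr_pdivlMr.
Qed.

Lemma l1N f : l1 (fun k => - f k)%R = l1 f.
Proof. by apply: eq_l1 => k; rewrite cabsN. Qed.

Lemma csumN f : (l1 f < +oo)%E -> csum (fun k => - f k) = - csum f.
Proof.
by move=> foo; rewrite -mulN1r -csumZ//; apply: eq_csum => k; rewrite mulN1r.
Qed.

Lemma l10 : l1 (fun=> 0) = 0%E.
Proof. by apply: esum1 => k _; rewrite cabs0. Qed.

Lemma csum0 : csum (fun=> 0) = 0.
Proof.
have := cabs_csum (fun=> 0); rewrite l10 lee_fin => le0.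
by apply: cabs0_eq0; apply/eqP; rewrite eq_le le0 cabs_ge0.
Qed.

Lemma l1_sum n (F : 'I_n -> int -> R[i]) : (forall i, l1 (F i) < +oo)%E ->
  (l1 (fun k => \sum_(i < n) F i k)%R < +oo)%E.
Proof.
elim: n F => [|n IH] F Foo.
  suff -> : l1 (fun k => \sum_(i < 0) F i k) = 0%E by rewrite ltry.
  by apply: esum1 => k _; rewrite big_ord0 cabs0.
rewrite [l1 _](_ : _ = l1 (fun k => F ord0 k + \sum_(i < n) F (lift ord0 i) k)).
  by apply: le_lt_trans (l1D _ _) _; rewrite lte_add_pinfty// IH.
by apply: eq_l1 => k; rewrite big_ord_recl.
Qed.

Lemma csum_sum n (F : 'I_n -> int -> R[i]) : (forall i, l1 (F i) < +oo)%E ->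
  csum (fun k => \sum_(i < n) F i k) = \sum_(i < n) csum (F i).
Proof.
elim: n F => [|n IH] F Foo.
  rewrite big_ord0; apply: etrans csum0.
  by apply: eq_csum => k; rewrite big_ord0.
rewrite big_ord_recl -IH// -csumD//; last exact: l1_sum.
by apply: eq_csum => k; rewrite big_ord_recl.
Qed.

Lemma csum_supp0 f : (forall k, k != 0 -> f k = 0) -> csum f = f 0.
Proof.
move=> f0; apply: limn_cabs => e e0; apply: nearW => n.
rewrite [psum _ _](_ : _ = f 0) ?subrr ?cabs0//.
elim: n => [|n IH]; rewrite ?psum0// psumS IH.
by rewrite (f0 (- _)) ?(f0 n.+1%:Z) ?addr0 ?add0r.
Qed.

Lemma l1_supp0 f : (forall k, k != 0 -> f k = 0) -> l1 f = (cabs (f 0))%:E.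
Proof.
move=> f0; rewrite /l1 (esumID (box 0))// !setTI -psum_esum// psum0.
rewrite [X in (_ + X)%E]esum1 ?adde0// => k; rewrite /box /= => k0.
by rewrite f0 ?cabs0//; apply: contra_notN k0 => /eqP ->.
Qed.

(** Subtracting the n-th partial sum over [j] from the right-hand side leaves, for each [k], a tail
    bounded by [csum_tail]. By the exchange for nonnegative terms these bounds add up to the tail of
    the sum of the row norms, which tends to 0. *)
Lemma csum_exchange (F : int -> int -> R[i]) :
  (\esum_(j in [set: int]) l1 (F j) < +oo)%E ->
  csum (fun j => csum (F j)) = csum (fun k => csum (F ^~ k)).
Proof.
move=> Foo.
have rowoo j : (l1 (F j) < +oo)%E.
  apply: le_lt_trans Foo; apply: (le_esum_term (a := fun j => l1 (F j))) => i; exact: l1_ge0.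
have exch (A : set int) : (\esum_(j in A) l1 (F j) =
    \esum_(k in [set: int]) \esum_(j in A) (cabs (F j k))%:E)%E.
  by apply: exchange_esum => i j; exact: cabsE_ge0.
have Foo' : (\esum_(k in [set: int]) l1 (F ^~ k) < +oo)%E by rewrite -exch.
have coloo k : (l1 (F ^~ k) < +oo)%E.
  apply: le_lt_trans Foo'.
  by apply: (le_esum_term (a := fun k => l1 (F ^~ k))) => i; exact: l1_ge0.
have Goo : (l1 (fun k => csum (F ^~ k))%R < +oo)%E.
  by apply: le_lt_trans Foo'; apply: le_esum => k _; exact: cabs_csum.
apply: limn_cabs => e e0.
have tl := esum_tail_cvg (fun j => l1_ge0 (F j)) Foo e0.
apply: filterS tl => n tn; rewrite -lte_fin; apply: le_lt_trans tn.
have Poo : (l1 (fun k => psum (F ^~ k) n)%R < +oo)%E by exact: l1_sum.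
have -> : psum (fun j => csum (F j)) n = csum (fun k => psum (F ^~ k) n).
  by rewrite csum_sum.
rewrite -csumN// -csumD ?l1N//.
apply: le_trans (cabs_csum _) _; rewrite exch; apply: le_esum => k _.
exact: csum_tail.
Qed.

End ComplexSums.

(** * Fourier series *)

Section Fourier.
Variable R : realType.
Implicit Types (f g : int -> R[i]) (t : R[i]).

Definition fourier f t : R[i] := csum (fun k => f k * t ^ k).

Lemma l1_twist f t : cabs t = 1 -> l1 (fun k => f k * t ^ k) = l1 f.
Proof. by move=> t1; apply: eq_l1 => k; rewrite cabsM cabs_exprz1// mulr1. Qed.

Lemma fourierD f g t : cabs t = 1 -> (l1 f < +oo)%E -> (l1 g < +oo)%E ->
  fourier (fun k => f k + g k) t = fourier f t + fourier g t.
Proof.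
move=> t1 foo goo; rewrite /fourier -csumD ?l1_twist//.
by apply: eq_csum => k; rewrite mulrDl.
Qed.

Lemma fourierN f t : cabs t = 1 -> (l1 f < +oo)%E ->
  fourier (fun k => - f k) t = - fourier f t.
Proof.
move=> t1 foo; rewrite /fourier -csumN ?l1_twist//.
by apply: eq_csum => k; rewrite mulNr.
Qed.

Lemma psum_gap (V : nmodType) (f : int -> V) n :
  (forall k : int, k != 0 -> (`|k| <= n)%N -> f k = 0) -> psum f n = f 0.
Proof.
elim: n => [|n IH] f0; first by rewrite psum0.
rewrite psumS IH => [|k k0 kn]; last by rewrite f0// ltnW.
by rewrite (f0 (- _)) ?(f0 n.+1%:Z) ?addr0 ?add0r//; lia.
Qed.

Let sel f (j : nat) (k : int) : R[i] := if ((2 ^ j)%N%:Z %| k)%Z then f k else 0.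

Let l1_sel f j : (l1 (sel f j) <= l1 f)%E.
Proof. by apply: le_l1 => k; rewrite /sel; case: ifP => // _; rewrite cabs0 cabs_ge0. Qed.

Lemma exists_unit_root_N1 n : (0 < n)%N -> exists2 s : R[i], cabs s = 1 & s ^+ n = -1.
Proof.
move=> n0; exists (n.-root (-1 : R[i])); last by rewrite rootCK.
apply/eqP; rewrite -(@pexpr_eq1 _ _ n) ?cabs_ge0// -cabsX rootCK//.
by rewrite cabsN cabs1.
Qed.

(* Averaging over t and ts, where s^(2^j) = -1, kills the frequencies that are
   odd multiples of 2^j. *)
Let fourier_sel f j : (l1 f < +oo)%E ->
  (forall t, cabs t = 1 -> fourier f t = 0) ->
  forall t, cabs t = 1 -> fourier (sel f j) t = 0.
Proof.
move=> foo f0; elim: j => [|j IH] t t1.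
  by rewrite -[RHS](f0 t t1); apply: eq_csum => k; rewrite /sel expn0 dvd1z.
have [s s1 sN1] := @exists_unit_root_N1 (2 ^ j) (expn_gt0 2 j).
have ts1 : cabs (t * s) = 1 by rewrite cabsM t1 s1 mulr1.
have seloo i : (l1 (sel f i) < +oo)%E by exact: le_lt_trans (l1_sel _ _) foo.
have two0 : (2 : R[i]) != 0 by rewrite pnatr_eq0.
apply: (mulfI two0); rewrite mulr0 -[RHS](addr0 0) -{1}(IH t t1) -(IH _ ts1).
rewrite /fourier -csumZ ?l1_twist// -csumD ?l1_twist//.
apply: eq_csum => k; rewrite /sel.
have [/dvdzP[q ->]|ndv] := boolP ((2 ^ j)%N%:Z %| k)%Z; last first.
  rewrite ifN ?mul0r ?mulr0 ?addr0//; apply: contra ndv; apply: dvdz_trans.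
  by rewrite expnS PoszM dvdz_mull.
have sk : s ^ (q * (2 ^ j)%N%:Z) = (-1) ^ q.
  by rewrite mulrC -exprz_exp -[s ^ _]/(s ^+ (2 ^ j)%N) sN1.
rewrite expfzMl sk expnS PoszM dvdz_mul2r; last by rewrite -lt0n expn_gt0.
have [qe|qo] := boolP (2 %| q)%Z.
  have -> : (-1) ^ q = 1 :> R[i].
    move: qe => /dvdzP[r ->]; rewrite mulrC -exprz_exp.
    by rewrite -[(-1) ^ 2]/((-1) ^+ 2) sqrrN expr1n exp1rz.
  by rewrite mulr1 mulr_natl mulr2n.
rewrite [(-1) ^ q](_ : _ = -1); first by rewrite mul0r mulr0 mulrN1 mulrN subrr.
have -> : q = 2 * (q %/ 2)%Z + 1 by lia.
rewrite expfzDr ?oppr_eq0 ?oner_eq0// -exprz_exp -[(-1) ^ 2]/((-1) ^+ 2).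
by rewrite sqrrN expr1n exp1rz mul1r.
Qed.

(** Since n < 2^n, the only multiple of 2^n in the box of radius n is 0. The series of [sel f n]
    vanishes at t = 1, so [f 0] is minus a tail of it, and tails are arbitrarily small. *)
Let fourier0_coef0 f : (l1 f < +oo)%E ->
  (forall t, cabs t = 1 -> fourier f t = 0) -> f 0 = 0.
Proof.
move=> foo f0; apply: cabs0_eq0; apply/eqP; rewrite eq_le cabs_ge0 andbT.
apply/ler_addgt0Pr => e e0; rewrite add0r.
have [n _ /(_ n (leqnn n)) tn] := esum_tail_cvg (cabsE_ge0 f) foo e0.
have seloo : (l1 (sel f n) < +oo)%E by exact: le_lt_trans (l1_sel _ _) foo.
have sum0 : csum (sel f n) = 0.
  rewrite -[RHS](fourier_sel n foo f0 (cabs1 R)).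
  by apply: eq_csum => k; rewrite exp1rz mulr1.
have := csum_tail n seloo; rewrite sum0 psum_gap.
  rewrite /sel dvdz0 sub0r cabsN -lee_fin => /le_trans; apply.
  apply: le_trans (ltW tn); apply: le_esum => k _; rewrite lee_fin.
  by case: ifP => // _; rewrite cabs0 cabs_ge0.
move=> k k0 kn; rewrite /sel ifN//; apply: contra k0 => /dvdzP[q kq].
have [q0|q0] := eqVneq q 0; first by rewrite kq q0 mul0r.
have qn : (2 ^ n <= absz q * 2 ^ n)%N by rewrite leq_pmull ?absz_gt0.
by move: kn; rewrite kq abszM /= leqNgt (leq_trans (ltn_expl n _) qn).
Qed.

Lemma fourier_shift f t (m : int) : cabs t = 1 -> (l1 f < +oo)%E ->
  fourier (fun k => f (k + m)) t = t ^ (- m) * fourier f t.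
Proof.
move=> t1 foo; rewrite /fourier -(@csum_shift _ (fun k => f k * t ^ k) m) ?l1_twist//.
rewrite -csumZ; last by rewrite (l1_shift (fun k => f k * t ^ k)) l1_twist.
apply: eq_csum => k; rewrite mulrCA -expfzDr ?cabs1_neq0//.
by rewrite addrCA addNr addr0.
Qed.

Lemma fourier_inj f g : (l1 f < +oo)%E -> (l1 g < +oo)%E ->
  (forall t, cabs t = 1 -> fourier f t = fourier g t) -> f =1 g.
Proof.
move=> foo goo fg m; apply/eqP; rewrite -subr_eq0; apply/eqP.
pose h k := f k - g k.
have hoo : (l1 h < +oo)%E.
  by apply: le_lt_trans (l1D _ _) _; rewrite l1N lte_add_pinfty.
have := @fourier0_coef0 (fun k => h (k + m)); rewrite add0r; apply.
  by rewrite l1_shift.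
move=> t t1; rewrite fourier_shift// /h fourierD// ?l1N//.
by rewrite fourierN// fg// subrr mulr0.
Qed.

Definition conv f g (k : int) : R[i] := csum (fun j => f j * g (k - j)).

Let l1_conv_rows f g :
  (\esum_(j in [set: int]) l1 (fun k => f j * g (k - j))%R <= l1 f * l1 g)%E.
Proof.
rewrite muleC; apply: le_trans (le_esumZ _ (l1_ge0 g) (cabsE_ge0 f)).
apply: le_esum => j _; rewrite muleC -(l1_shift g (- j)); exact: l1Z.
Qed.

Lemma l1_conv f g : (l1 (conv f g) <= l1 f * l1 g)%E.
Proof.
apply: le_trans (l1_conv_rows f g).
apply: (@le_trans _ _ (\esum_(k in [set: int]) l1 (fun j => f j * g (k - j))%R)%E).
  by apply: le_esum => k _; exact: cabs_csum.
rewrite /l1 (@exchange_esum _ _ _ (fun k j => (cabs (f j * g (k - j)))%:E))//.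
by move=> i j; rewrite lee_fin cabs_ge0.
Qed.

Lemma l1_conv_lty f g : (l1 f < +oo)%E -> (l1 g < +oo)%E -> (l1 (conv f g) < +oo)%E.
Proof.
move=> foo goo; apply: le_lt_trans (l1_conv f g) _.
by apply: lte_mul_pinfty; rewrite ?l1_ge0// ge0_fin_numE ?l1_ge0.
Qed.

Lemma l1_conv_col f g k : (l1 f < +oo)%E -> (l1 g < +oo)%E ->
  (l1 (fun j => f j * g (k - j))%R < +oo)%E.
Proof.
move=> foo goo; have gfin : l1 g \is a fin_num by rewrite ge0_fin_numE ?l1_ge0.
apply: (@le_lt_trans _ _ (l1 (fun j => ((fine (l1 g))%:C)%C * f j)%R)).
  apply: le_l1 => j; rewrite !cabsM mulrC ler_wpM2r ?cabs_ge0//.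
  rewrite cabs_real ger0_norm ?fine_ge0 ?l1_ge0// -lee_fin fineK//.
  exact: le_cabs_l1.
apply: le_lt_trans (l1Z _ _) _.
by apply: lte_mul_pinfty; rewrite ?lee_fin ?cabs_ge0.
Qed.

Lemma csum_conv f g : (l1 f < +oo)%E -> (l1 g < +oo)%E ->
  csum (conv f g) = csum f * csum g.
Proof.
move=> foo goo; rewrite /conv -(@csum_exchange _ (fun j k => f j * g (k - j))).
  rewrite mulrC -csumZ//; apply: eq_csum => j.
  by rewrite csumZ ?l1_shift// csum_shift// mulrC.
apply: le_lt_trans (l1_conv_rows f g) _.
by apply: lte_mul_pinfty; rewrite ?l1_ge0// ge0_fin_numE ?l1_ge0.
Qed.

(** As t^j t^(k-j) = t^k, twisting a convolution by [t ^ k] gives the convolution of the twisted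
    families, to which [csum_conv] applies. *)
Lemma fourier_conv f g t : cabs t = 1 -> (l1 f < +oo)%E -> (l1 g < +oo)%E ->
  fourier (conv f g) t = fourier f t * fourier g t.
Proof.
move=> t1 foo goo; rewrite /fourier -csum_conv ?l1_twist//.
apply: eq_csum => k; rewrite mulrC -(csumZ _ (l1_conv_col k foo goo)).
apply: eq_csum => j; rewrite mulrACA -expfzDr ?cabs1_neq0// addrCA subrr addr0.
by rewrite mulrC.
Qed.

End Fourier.

(** * The Wiener algebra *)

Section WienerAlgebra.
Variable R : realType.

(** Bundled with absolute convergence, the scalar families form a commutative ring. Over such a ring
    a one-sided inverse of a square matrix is two-sided ([mulmx1C]). *)
Record wiener := Wiener { wcoef :> int -> R[i]; wcoef_l1 : (l1 wcoef < +oo)%E }.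

Lemma wiener_ext (u v : wiener) : u =1 v -> u = v.
Proof.
case: u v => [u hu] [v hv] /= /funext uv; case: _ / uv hv => hv.
by congr Wiener; exact: bool_irrelevance.
Qed.

Lemma fourier_ext (u v : wiener) :
  (forall t, cabs t = 1 -> fourier u t = fourier v t) -> u = v.
Proof. by move=> uv; apply/wiener_ext/fourier_inj => //; exact: wcoef_l1. Qed.

HB.instance Definition _ := gen_eqMixin wiener.
HB.instance Definition _ := gen_choiceMixin wiener.

Implicit Types u v w : wiener.

Fact l1_0_lty : (l1 (fun _ : int => 0 : R[i])%R < +oo)%E.
Proof. by rewrite l10 ltry. Qed.

Fact l1D_lty u v : (l1 (fun k => u k + v k)%R < +oo)%E.
Proof.
by apply: le_lt_trans (l1D _ _) _; rewrite lte_add_pinfty//; exact: wcoef_l1.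
Qed.

Fact l1N_lty u : (l1 (fun k => - u k)%R < +oo)%E.
Proof. rewrite l1N; exact: wcoef_l1. Qed.

Definition wzero := Wiener l1_0_lty.
Definition wadd u v := Wiener (l1D_lty u v).
Definition wopp u := Wiener (l1N_lty u).

Let waddA : associative wadd.
Proof. by move=> u v w; apply: wiener_ext => k /=; rewrite addrA. Qed.
Let waddC : commutative wadd.
Proof. by move=> u v; apply: wiener_ext => k /=; rewrite addrC. Qed.
Let wadd0 : left_id wzero wadd.
Proof. by move=> u; apply: wiener_ext => k /=; rewrite add0r. Qed.
Let waddN : left_inverse wzero wopp wadd.
Proof. by move=> u; apply: wiener_ext => k /=; rewrite addNr. Qed.

HB.instance Definition _ := GRing.isZmodule.Build wiener waddA waddC wadd0 waddN.

Let mono_coef (m k : int) : R[i] := (k == m)%:R.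

Let mono_shift (m : int) : mono_coef m = (fun k : int => mono_coef 0 (k - m)).
Proof. by apply: funext => k; rewrite /mono_coef subr_eq0. Qed.

Let l1_mono (m : int) : l1 (mono_coef m) = 1%E.
Proof.
rewrite mono_shift l1_shift l1_supp0 /mono_coef ?eqxx ?cabs1//.
by move=> k /negPf ->.
Qed.

Fact l1_mono_lty (m : int) : (l1 (mono_coef m) < +oo)%E.
Proof. by rewrite l1_mono ltry. Qed.

Definition mono (m : int) : wiener := Wiener (l1_mono_lty m).

Definition wmul u v := Wiener (l1_conv_lty (wcoef_l1 u) (wcoef_l1 v)).

Lemma fourier_mono (m : int) t : cabs t = 1 -> fourier (mono m) t = t ^ m.
Proof.
move=> t1.
have {1}-> : (mono m : int -> R[i]) = (fun k => mono 0 (k - m)) by exact: mono_shift.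
rewrite fourier_shift ?opprK; [|by []|exact: wcoef_l1].
rewrite /fourier csum_supp0 /= /mono_coef ?eqxx ?mulr1//.
by move=> k /negPf ->; rewrite mul0r.
Qed.

Let fourier_wmul u v t : cabs t = 1 -> fourier (wmul u v) t = fourier u t * fourier v t.
Proof. by move=> t1; apply: fourier_conv => //; exact: wcoef_l1. Qed.

Let fourier_wadd u v t : cabs t = 1 -> fourier (u + v) t = fourier u t + fourier v t.
Proof. by move=> t1; apply: fourierD => //; exact: wcoef_l1. Qed.

Let wmulA : associative wmul.
Proof. by move=> u v w; apply: fourier_ext => t t1; rewrite !fourier_wmul// mulrA. Qed.
Let wmulC : commutative wmul.
Proof. by move=> u v; apply: fourier_ext => t t1; rewrite !fourier_wmul// mulrC. Qed.
Let wmul1 : left_id (mono 0) wmul.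
Proof.
by move=> u; apply: fourier_ext => t t1; rewrite fourier_wmul// fourier_mono// mul1r.
Qed.
Let wmulDl : left_distributive wmul +%R.
Proof.
move=> u v w; apply: fourier_ext => t t1.
by rewrite fourier_wadd// !fourier_wmul// fourier_wadd// mulrDl.
Qed.
Let wone_neq0 : mono 0 != 0.
Proof.
apply/eqP => /(congr1 (fun u : wiener => u 0)) /=; rewrite /mono_coef eqxx.
by move/eqP; rewrite oner_eq0.
Qed.

HB.instance Definition _ :=
  GRing.Zmodule_isComNzRing.Build wiener wmulA wmulC wmul1 wmulDl wone_neq0.

Lemma wcoef0 k : (0 : wiener) k = 0. Proof. by []. Qed.
Lemma wcoefD u v k : (u + v) k = u k + v k. Proof. by []. Qed.
Lemma wcoefN u k : (- u) k = - u k. Proof. by []. Qed.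
Lemma wcoefB u v k : (u - v) k = u k - v k. Proof. by []. Qed.
Lemma wcoefM u v k : (u * v) k = csum (fun j => u j * v (k - j)). Proof. by []. Qed.
Lemma wcoef_mono m k : mono m k = (k == m)%:R. Proof. by []. Qed.
Lemma wcoef1 k : (1 : wiener) k = (k == 0)%:R. Proof. by []. Qed.
Lemma wcoef_sum n (F : 'I_n -> wiener) k : (\sum_(i < n) F i) k = \sum_(i < n) F i k.
Proof. by elim/big_rec2: _ => [|i y1 y2 _ <-]; rewrite ?wcoef0. Qed.

Lemma fourierM u v t : cabs t = 1 -> fourier (u * v) t = fourier u t * fourier v t.
Proof. exact: fourier_wmul. Qed.

Lemma monoD (m n : int) : mono (m + n) = mono m * mono n.
Proof.
apply: fourier_ext => t t1; rewrite fourierM// !fourier_mono//.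
by rewrite expfzDr// cabs1_neq0.
Qed.

(** With the modulus condition bundled, [wev t] is a ring morphism for every point, so matrix
    identities pass through [map_mx]. *)
Record circle := Circle { circle_val :> R[i]; circleP : cabs circle_val = 1 }.

Definition wev (t : circle) (u : wiener) : R[i] := fourier u t.

Let wev_zmod t : zmod_morphism (wev t).
Proof.
move=> u v; rewrite /wev fourierD ?fourierN//; try exact: wcoef_l1; exact: circleP.
Qed.
Let wev_monoid t : monoid_morphism (wev t).
Proof.
split=> [|u v]; rewrite /wev; last by apply: fourierM; exact: circleP.
by rewrite fourier_mono//; exact: circleP.
Qed.

HB.instance Definition _ t := GRing.isZmodMorphism.Build wiener R[i] (wev t) (wev_zmod t).
HB.instance Definition _ t := GRing.isMonoidMorphism.Build wiener R[i] (wev t) (wev_monoid t).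

Lemma wev_ext u v : (forall t, wev t u = wev t v) -> u = v.
Proof. by move=> uv; apply: fourier_ext => t t1; exact: (uv (Circle t1)). Qed.

Lemma wev_mono t m : wev t (mono m) = (t : R[i]) ^ m.
Proof. by rewrite /wev fourier_mono//; exact: circleP. Qed.

Definition wnm u : R := fine (l1 u).

Lemma wnmE u : (wnm u)%:E = l1 u.
Proof. by rewrite /wnm fineK// ge0_fin_numE ?l1_ge0//; exact: wcoef_l1. Qed.

Lemma wnm_ge0 u : 0 <= wnm u. Proof. by rewrite -lee_fin wnmE l1_ge0. Qed.

Lemma le_wnm u v : (forall k, cabs (u k) <= cabs (v k)) -> wnm u <= wnm v.
Proof. by move=> uv; rewrite -lee_fin !wnmE le_l1. Qed.

Lemma wnm0 : wnm 0 = 0.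
Proof. by apply/eqP; rewrite -eqe wnmE l10. Qed.

Lemma wnm_mono m : wnm (mono m) = 1.
Proof. by apply/eqP; rewrite -eqe wnmE l1_mono. Qed.

Lemma wnm0_eq0 u : wnm u = 0 -> u = 0.
Proof.
move=> u0; apply: wiener_ext => k; apply: cabs0_eq0; apply/eqP.
rewrite eq_le cabs_ge0 andbT -lee_fin; apply: le_trans (le_cabs_l1 u k) _.
by rewrite -wnmE u0.
Qed.

Lemma wnmD u v : wnm (u + v) <= wnm u + wnm v.
Proof. by rewrite -lee_fin EFinD !wnmE; exact: l1D. Qed.

Lemma wnmN u : wnm (- u) = wnm u.
Proof. by apply/eqP; rewrite -eqe !wnmE l1N. Qed.

Lemma wnmM u v : wnm (u * v) <= wnm u * wnm v.
Proof. by rewrite -lee_fin EFinM !wnmE; exact: l1_conv. Qed.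

Fact l1_mask (s : pred int) u : (l1 (fun k => if s k then u k else 0)%R < +oo)%E.
Proof.
apply: le_lt_trans (wcoef_l1 u); apply: le_l1 => k.
by case: ifP => // _; rewrite cabs0 cabs_ge0.
Qed.

Definition wmask (s : pred int) u : wiener := Wiener (l1_mask s u).

Lemma wmaskE s u k : wmask s u k = if s k then u k else 0. Proof. by []. Qed.

Lemma wmaskB s u v : wmask s (u - v) = wmask s u - wmask s v.
Proof.
apply: wiener_ext => k; rewrite wcoefB !wmaskE.
by case: ifP; rewrite ?subrr// wcoefB.
Qed.

Lemma wnm_mask s u : wnm (wmask s u) <= wnm u.
Proof.
by apply: le_wnm => k; rewrite wmaskE; case: ifP => // _; rewrite cabs0 cabs_ge0.
Qed.

Lemma wmask_compl s u : wmask s u + wmask (predC s) u = u.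
Proof.
by apply: wiener_ext => k; rewrite wcoefD !wmaskE /=; case: (s k); rewrite ?addr0 ?add0r.
Qed.

Lemma wnm_tail_cvg u (e : R) : 0 < e ->
  \forall n \near \oo, wnm (wmask (fun k : int => (n < absz k)%N) u) < e.
Proof.
move=> e0; apply: filterS (esum_tail_cvg (cabsE_ge0 u) (wcoef_l1 u) e0) => n.
rewrite -lte_fin wnmE; apply: le_lt_trans.
rewrite [leRHS]esum_mkcond; apply: le_esum => k _; rewrite wmaskE.
case: ifPn => nk; last by rewrite cabs0; case: ifP => // _; rewrite lee_fin cabs_ge0.
by rewrite ifT// inE /= /box /=; apply/negP; rewrite -ltnNge.
Qed.

End WienerAlgebra.

(** * Completeness *)

Section Limits.
Variable R : realType.
Local Notation W := (wiener R).

Lemma le_addgeo (x a K : R) : (forall n, x <= a + K / 2 ^+ n) -> x <= a.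
Proof.
move=> xaK; apply/ler_addgt0Pr => e e0.
have K1 : 0 < `|K| + 1 by rewrite ltr_wpDl.
have eK : 0 < e / (`|K| + 1) by rewrite divr_gt0.
have [n _ /(_ n (leqnn n)) /= nlt] := near_infty_natSinv_expn_lt (PosNum eK).
apply: le_trans (xaK n) _; rewrite lerD2l.
have : 1 / 2 ^+ n * (`|K| + 1) < e by rewrite -ltr_pdivlMr.
move=> /ltW; apply: le_trans; rewrite mulrC mul1r ler_pM2l ?invr_gt0 ?exprn_gt0//.
by rewrite (le_trans (ler_norm K))// lerDl.
Qed.

Lemma psum_nat (V : nmodType) (f : int -> V) n : (forall k : int, k < 0 -> f k = 0) ->
  psum f n = \sum_(m < n.+1) f m%:Z.
Proof.
move=> f0; elim: n => [|n IH]; first by rewrite psum0 big_ord1.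
rewrite psumS IH (f0 (- _)) ?add0r; last by lia.
by rewrite [RHS]big_ord_recr.
Qed.

Lemma esum_le_psum (g : int -> \bar R) (B : \bar R) : (forall k, (0 <= g k)%E) ->
  (forall n, (psum g n <= B)%E) -> (\esum_(k in [set: int]) g k <= B)%E.
Proof.
move=> g0 gB; apply: ge_ereal_sup => _ /= [X [fX _] <-].
have [n Xn] := sub_box fX; apply: le_trans (gB n).
by rewrite psum_esum// -esum_fset//; exact: esum_subset.
Qed.

Lemma esum_geo (g : int -> \bar R) (C q : R) :
  (forall k, (0 <= g k)%E) -> (forall k : int, k < 0 -> g k = 0%E) ->
  0 <= C -> 0 <= q < 1 -> (forall n : nat, (g n%:Z <= (C * q ^+ n)%:E)%E) ->
  (\esum_(k in [set: int]) g k <= (C / (1 - q))%:E)%E.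
Proof.
move=> g0 gneg C0 /andP[q0 q1] gC; apply: esum_le_psum => // n; rewrite psum_nat//.
apply: (@le_trans _ _ (\sum_(m < n.+1) (C * q ^+ m)%:E)%E); first exact: lee_sum.
rewrite sumEFin lee_fin; have q1' : 0 < 1 - q by rewrite subr_gt0.
suff -> : \sum_(m < n.+1) C * q ^+ m = C * (1 - q ^+ n.+1) / (1 - q).
  rewrite ler_pM2r ?invr_gt0// -[leRHS]mulr1 ler_wpM2l//.
  by rewrite lerBlDr lerDl exprn_ge0.
elim: n.+1 => [|m IH]; first by rewrite big_ord0 expr0 subrr mulr0 mul0r.
by rewrite big_ord_recr /= IH exprS; field; rewrite gt_eqF.
Qed.

(** Completeness with an explicit rate. The terms are the rows of a double family; exchanging
    nonnegative sums bounds its column sums, which are the coefficients of [S]. *)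
Lemma wiener_series (U : nat -> W) (C : R) : 0 <= C ->
  (forall n, wnm (U n) <= C / 4 ^+ n) ->
  exists S : W, forall n, wnm (S - \sum_(i < n) U i) <= 2 * C / 2 ^+ n.
Proof.
move=> C0 UC.
(* [F n] keeps only the rows of index at least [n], so its column sums are the coefficients of the
   n-th remainder. *)
pose F (n : nat) (j k : int) : R[i] :=
  if j is Posz m then (if (n <= m)%N then U m k else 0) else 0.
(* For m >= n, 4^-m <= 2^-n 2^-m: one half of the decay gives the rate, the other a geometric series
   of ratio 1/2. *)
have rows n : (\esum_(j in [set: int]) l1 (F n j) <= (2 * C / 2 ^+ n)%:E)%E.
  have -> : 2 * C / 2 ^+ n = (C / 2 ^+ n) / (1 - 1 / 2) by field; rewrite expf_neq0.
  apply: esum_geo => [j|j j0|||m]; rewrite ?l1_ge0//.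
  - by case: j j0 => // m _; exact: l10.
  - by rewrite divr_ge0// exprn_ge0.
  - by lra.
  rewrite /F; case: leqP => nm; last by rewrite l10 lee_fin mulr_ge0 ?divr_ge0 ?exprn_ge0.
  rewrite -wnmE lee_fin (le_trans (UC m))// expr_div_n expr1n mul1r -mulrA ler_wpM2l//.
  have -> : (4 : R) ^+ m = 2 ^+ m * 2 ^+ m by rewrite -exprMn; congr (_ ^+ _); ring.
  rewrite invfM ler_wpM2r ?invr_ge0 ?exprn_ge0// lef_pV2 ?posrE ?exprn_gt0//.
  by rewrite ler_weXn2l// ler1n.
have cols n : (\esum_(k in [set: int]) l1 (F n ^~ k) <= (2 * C / 2 ^+ n)%:E)%E.
  apply: le_trans (rows n).
  rewrite /l1 (@exchange_esum _ _ _ (fun k j => (cabs (F n j k))%:E))//.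
  by move=> i j; rewrite lee_fin cabs_ge0.
have col n k : (l1 (F n ^~ k) < +oo)%E.
  apply: le_lt_trans (ltry (2 * C / 2 ^+ n)); apply: le_trans (cols n).
  by apply: (le_esum_term (a := fun k => l1 (F n ^~ k))) => i; exact: l1_ge0.
have Sl1 n : (l1 (fun k => csum (F n ^~ k)) <= (2 * C / 2 ^+ n)%:E)%E.
  by apply: le_trans (cols n); apply: le_esum => k _; exact: cabs_csum.
have Soo n : (l1 (fun k => csum (F n ^~ k)) < +oo)%E by exact: le_lt_trans (Sl1 n) (ltry _).
have step n k : csum (F n ^~ k) = U n k + csum (F n.+1 ^~ k).
  (* Row [n] alone, as a shift of a family supported at 0. *)
  pose d (j : int) : R[i] := if j == 0 then U n k else 0.
  have doo : (l1 d < +oo)%E.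
    by rewrite l1_supp0 ?ltry// => j /negPf; rewrite /d => ->.
  have -> : U n k = csum (fun j => d (j - n%:Z)).
    by rewrite csum_shift// csum_supp0 /d ?eqxx// => j /negPf ->.
  rewrite -csumD ?l1_shift//; apply: eq_csum => -[m|m]; rewrite /F /d; last first.
    by rewrite ifN ?addr0//; lia.
  rewrite subr_eq0 eqz_nat; have [->|mn] := eqVneq m n.
    by rewrite leqnn ltnn addr0.
  by rewrite add0r ltn_neqAle eq_sym mn.
exists (Wiener (Soo 0)) => n.
suff -> : Wiener (Soo 0) - \sum_(i < n) U i = Wiener (Soo n).
  by rewrite -lee_fin wnmE; exact: Sl1.
apply: wiener_ext => k; rewrite wcoefB wcoef_sum.
elim: n => [|n IH]; first by rewrite big_ord0 subr0.
rewrite big_ord_recr /= opprD addrA [X in X - _](_ : _ = csum (F n ^~ k))//.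
by rewrite step addrAC subrr add0r.
Qed.

End Limits.

(** * Matrices over the Wiener algebra: a norm and a fixed point theorem *)

Section MatrixNorm.
Variables (R : realType) (p : nat).
Local Notation M := 'M[wiener R]_p.
Implicit Types A B : M.

(** Submultiplicative, and an upper bound for [wnorm] by [wnorm_coef_mx]. The identity has norm p,
    whence the powers of p in later bounds. *)
Definition mnm A : R := \sum_i \sum_j wnm (A i j).

Lemma mnm_ge0 A : 0 <= mnm A.
Proof. by do 2!apply: sumr_ge0 => ? _; exact: wnm_ge0. Qed.

Lemma le_wnm_mnm A i j : wnm (A i j) <= mnm A.
Proof.
rewrite /mnm (bigD1 i)//= (bigD1 j)//= -addrA lerDl addr_ge0//.
  by apply: sumr_ge0 => ? _; exact: wnm_ge0.
by do 2!apply: sumr_ge0 => ? _; exact: wnm_ge0.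
Qed.

Lemma mnm0 : mnm 0 = 0.
Proof. by rewrite /mnm !big1// => i _; rewrite big1// => j _; rewrite mxE wnm0. Qed.

Lemma mnm0_eq0 A : mnm A = 0 -> A = 0.
Proof.
move=> A0; apply/matrixP => i j; rewrite mxE; apply: wnm0_eq0; apply/eqP.
by rewrite eq_le wnm_ge0 andbT -A0 le_wnm_mnm.
Qed.

Lemma mnmD A B : mnm (A + B) <= mnm A + mnm B.
Proof.
rewrite /mnm -big_split ler_sum// => i _; rewrite -big_split ler_sum// => j _.
by rewrite mxE wnmD.
Qed.

Lemma mnmN A : mnm (- A) = mnm A.
Proof. by do 2!apply: eq_bigr => ? _; rewrite mxE wnmN. Qed.

Lemma mnmBC A B : mnm (A - B) = mnm (B - A).
Proof. by rewrite -mnmN opprB. Qed.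

Lemma mnmM A B : mnm (A *m B) <= mnm A * mnm B.
Proof.
rewrite /mnm mulr_suml ler_sum// => i _.
apply: (@le_trans _ _ (\sum_j \sum_k wnm (A i k) * wnm (B k j))).
  apply: ler_sum => j _; rewrite mxE.
  elim/big_rec2: _ => [|k x y _ xy]; first by rewrite wnm0.
  by rewrite (le_trans (wnmD _ _))// lerD// wnmM.
rewrite exchange_big mulr_suml ler_sum// => k _ /=.
rewrite -mulr_sumr ler_wpM2l ?wnm_ge0//.
rewrite [leRHS](bigD1 k)//= lerDl; by do 2!apply: sumr_ge0 => ? _; exact: wnm_ge0.
Qed.

(** Banach's theorem on the ball of radius [r]. The bound r / 2 on [Phi 0] and the ratio 1/4 keep
    the iterates in the ball, and 1/4 is the rate that [wiener_series] expects. *)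
Lemma contraction_fixpoint (Phi : M -> M) (r : R) :
  mnm (Phi 0) <= r / 2 ->
  (forall A B, mnm A <= r -> mnm B <= r -> mnm (Phi A - Phi B) <= mnm (A - B) / 4) ->
  exists2 A, mnm A <= r & Phi A = A.
Proof.
move=> Phi0 PhiC; pose z n := iter n Phi 0.
have r0 : 0 <= r by have := mnm_ge0 (Phi 0); lra.
have zr n : mnm (z n) <= r.
  elim: n => [|n IH]; first by rewrite mnm0.
  have := mnmD (Phi (z n) - Phi 0) (Phi 0); rewrite subrK -[Phi (z n)]/(z n.+1).
  have := PhiC (z n) 0 IH; rewrite mnm0 subr0 => /(_ r0).
  by rewrite -[Phi (z n)]/(z n.+1); lra.
have dz n : mnm (z n.+1 - z n) <= r / 4 ^+ n.
  elim: n => [|n IH].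
    by rewrite subr0 expr0 divr1 (le_trans Phi0)//; lra.
  have := PhiC (z n.+1) (z n) (zr n.+1) (zr n).
  rewrite -[Phi (z n.+1)]/(z n.+2) -[Phi (z n)]/(z n.+1) => /le_trans; apply.
  have -> : r / 4 ^+ n.+1 = r / 4 ^+ n / 4 by rewrite exprS; field; rewrite expf_neq0.
  by rewrite ler_pM2r ?invr_gt0.
have lim_ij (ij : 'I_p * 'I_p) : exists S : wiener R,
    forall n, wnm (S - z n ij.1 ij.2) <= 2 * r / 2 ^+ n.
  have dzij n : wnm ((z n.+1 - z n) ij.1 ij.2) <= r / 4 ^+ n.
    exact: le_trans (le_wnm_mnm _ _ _) (dz n).
  have [S SP] := wiener_series r0 dzij; exists S => n.
  have := SP n; rewrite (_ : \sum_(i < n) _ = z n ij.1 ij.2)//.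
  elim: n => [|n IH]; first by rewrite big_ord0 mxE.
  by rewrite big_ord_recr /= IH !mxE addrCA subrr addr0.
have [S SP] := choice lim_ij; pose Z := \matrix_(i, j) S (i, j).
(* The limit is taken entrywise, so the p^2 entry bounds are added up. *)
pose K := (\sum_(i < p) \sum_(j < p) 1) * (2 * r).
have Zz n : mnm (Z - z n) <= K / 2 ^+ n.
  rewrite /K -mulrA mulr_suml ler_sum// => i _; rewrite mulr_suml ler_sum// => j _.
  by rewrite !mxE mul1r; exact: (SP (i, j)).
have Zr : mnm Z <= r.
  apply: (le_addgeo (K := K)) => n; rewrite -[Z](subrK (z n)) addrC.
  by apply: le_trans (mnmD _ _) _; rewrite lerD.
exists Z => //; apply/eqP; rewrite -subr_eq0; apply/eqP/mnm0_eq0/eqP.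
rewrite eq_le mnm_ge0 andbT; apply: (le_addgeo (K := K * 2)) => n.
rewrite add0r.
have -> : Phi Z - Z = (Phi Z - Phi (z n)) + (z n.+1 - Z) by rewrite addrA subrK.
apply: le_trans (mnmD _ _) _; rewrite [mnm (z n.+1 - Z)]mnmBC.
have h1 := PhiC _ _ Zr (zr n); have h2 := Zz n; have h3 := Zz n.+1.
have h4 : K / 2 ^+ n.+1 = (K / 2 ^+ n) / 2 by rewrite exprS; field; rewrite expf_neq0.
have h5 : K * 2 / 2 ^+ n = 2 * (K / 2 ^+ n) by field; rewrite expf_neq0.
have h6 := mnm_ge0 (Z - z n).
lra.
Qed.

End MatrixNorm.

(** * Supports of coefficients *)

Section Supports.
Variables (R : realType) (p : nat).
Local Notation W := (wiener R).
Local Notation M := 'M[W]_p.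
Implicit Types (s : 'I_p -> 'I_p -> pred int) (A B : M) (rho : 'I_p -> int).

(** [s i j] holds at the frequencies allowed in entry (i, j). They vary with the entry because
    conjugation by diag(t^(rho i)) shifts each entry differently. *)
Definition msupp s A := forall i j k, ~~ s i j k -> A i j k = 0.

Definition mmask s A : M := \matrix_(i, j) wmask (s i j) (A i j).

Lemma msupp_mask s A : msupp s (mmask s A).
Proof. by move=> i j k /negPf sk; rewrite mxE wmaskE sk. Qed.

Lemma mmask_id s A : msupp s A -> mmask s A = A.
Proof.
move=> sA; apply/matrixP => i j; rewrite mxE; apply: wiener_ext => k.
by rewrite wmaskE; case: ifPn => // /sA ->.
Qed.

Lemma mmaskB s A B : mmask s (A - B) = mmask s A - mmask s B.
Proof. by apply/matrixP => i j; rewrite !mxE wmaskB. Qed.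

Lemma mmask0 s : mmask s 0 = 0.
Proof. by apply: mmask_id => i j k _; rewrite mxE. Qed.

Lemma mnm_mask s A : mnm (mmask s A) <= mnm A.
Proof. by do 2!apply: ler_sum => ? _; rewrite mxE wnm_mask. Qed.

Lemma mmask_compl s A : mmask s A + mmask (fun i j => predC (s i j)) A = A.
Proof. by apply/matrixP => i j; rewrite !mxE wmask_compl. Qed.

Lemma msuppD s A B : msupp s A -> msupp s B -> msupp s (A + B).
Proof. by move=> sA sB i j k nk; rewrite mxE wcoefD sA// sB// addr0. Qed.

Lemma msuppN s A : msupp s A -> msupp s (- A).
Proof. by move=> sA i j k nk; rewrite mxE wcoefN sA// oppr0. Qed.

Lemma msuppW s s' A : (forall i j k, s i j k -> s' i j k) -> msupp s A -> msupp s' A.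
Proof. by move=> ss' sA i j k nk; apply: sA; apply: contra nk; exact: ss'. Qed.

Definition minus_part : 'I_p -> 'I_p -> pred int := fun _ _ k => k <= 0.

(* The support of d A d^-1 for A in the plus algebra and d = diag(t^(rho i)). *)
Definition plus_part rho : 'I_p -> 'I_p -> pred int := fun i j k => rho i - rho j <= k.

Lemma wcoefM_eq0 (u v : W) k : (forall j, u j = 0 \/ v (k - j) = 0) -> (u * v) k = 0.
Proof.
move=> uv0; rewrite wcoefM -[RHS](csum0 R); apply: eq_csum => j.
by case: (uv0 j) => ->; rewrite ?mul0r ?mulr0.
Qed.

Lemma msuppM_minus A B : msupp minus_part A -> msupp minus_part B ->
  msupp minus_part (A *m B).
Proof.
move=> sA sB i j k; rewrite /minus_part => k0; rewrite mxE wcoef_sum big1// => l _.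
apply: wcoefM_eq0 => m; have [m0|m0] := leP m 0.
  by right; apply: sB; rewrite /minus_part; lia.
by left; apply: sA; rewrite /minus_part -ltNge.
Qed.

(** Frequencies add up in a product, and (rho i - rho l) + (rho l - rho j) = rho i - rho j. *)
Lemma msuppM_plus rho A B : msupp (plus_part rho) A -> msupp (plus_part rho) B ->
  msupp (plus_part rho) (A *m B).
Proof.
move=> sA sB i j k; rewrite /plus_part => k0; rewrite mxE wcoef_sum big1// => l _.
apply: wcoefM_eq0 => m; have [m0|m0] := leP (rho i - rho l) m.
  by right; apply: sB; rewrite /plus_part; lia.
by left; apply: sA; rewrite /plus_part -ltNge.
Qed.

Lemma msupp1_minus : msupp minus_part 1%:M.
Proof.
move=> i j k; rewrite /minus_part mxE; case: (i == j) => k0; rewrite ?wcoef0//.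
by rewrite wcoef1 gt_eqF// ltNge.
Qed.

Lemma msupp1_plus rho : msupp (plus_part rho) 1%:M.
Proof.
move=> i j k; rewrite /plus_part mxE; case: eqVneq => [->|_] k0; rewrite ?wcoef0//.
by rewrite wcoef1 lt_eqF//; lia.
Qed.

Lemma mnm1 : mnm (1%:M : M) = p%:R.
Proof.
rewrite /mnm -[in RHS](card_ord p) -sumr_const; apply: eq_bigr => i _.
rewrite (bigD1 i)//= mxE eqxx wnm_mono big1 ?addr0// => j ji.
by rewrite mxE eq_sym (negPf ji) wnm0.
Qed.

(** The inverse is a fixed point of v -> 1 - x v. The mask in [Phi] forces the support of the fixed
    point, and then acts trivially because [s] is closed under products. The radius is twice the
    norm of the identity. *)
Lemma small_inverse s x : msupp s 1%:M ->
  (forall A B, msupp s A -> msupp s B -> msupp s (A *m B)) ->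
  msupp s x -> mnm x <= 1 / 4 ->
  exists v, [/\ msupp s v, mnm v <= 2 * p%:R & (1%:M + x) *m v = 1%:M].
Proof.
move=> s1 sM sx x4; pose Phi v := 1%:M - mmask s (x *m v).
have Phi0 : mnm (Phi 0) <= 2 * p%:R / 2.
  by rewrite /Phi mulmx0 mmask0 subr0 mnm1; lra.
have PhiC A B : mnm A <= 2 * p%:R -> mnm B <= 2 * p%:R ->
    mnm (Phi A - Phi B) <= mnm (A - B) / 4.
  move=> _ _; rewrite /Phi opprB addrC addrA subrK -mmaskB -mulmxBr.
  rewrite (le_trans (mnm_mask _ _))// (le_trans (mnmM _ _))// [mnm (B - A)]mnmBC mulrC.
  by rewrite ler_wpM2l ?mnm_ge0//; lra.
have [v vr vE] := contraction_fixpoint Phi0 PhiC.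
have sv : msupp s v.
  by rewrite -vE; apply: msuppD => //; apply: msuppN; exact: msupp_mask.
exists v; split => //.
by rewrite mulmxDl mul1mx -{1}vE /Phi mmask_id ?subrK//; exact: sM.
Qed.

(* x and y solve x + y = e - xy: the map z |-> e - (P_X z)(P_Y z) is a
   contraction of a small ball. *)
Lemma small_factorisation s e : mnm e <= 1 / 16 ->
  exists x y, [/\ msupp (fun i j => predC (s i j)) x, msupp s y,
    mnm x <= 1 / 8, mnm y <= 1 / 8 & (1%:M + x) *m (1%:M + y) = 1%:M + e].
Proof.
move=> e16; pose X := mmask (fun i j => predC (s i j)); pose Y := mmask s.
pose Phi z := e - X z *m Y z.
have Phi0 : mnm (Phi 0) <= 1 / 8 / 2 by rewrite /Phi /X mmask0 mul0mx subr0; lra.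
have PhiC A B : mnm A <= 1 / 8 -> mnm B <= 1 / 8 ->
    mnm (Phi A - Phi B) <= mnm (A - B) / 4.
  (* By bilinearity the difference splits into two terms, each with a factor at most the radius 1/8;
     together they give the ratio 1/4. *)
  move=> A8 B8; have -> : Phi A - Phi B = X (B - A) *m Y B + X A *m Y (B - A).
    rewrite /Phi /X /Y !mmaskB mulmxBl mulmxBr opprB addrC addrA subrK.
    by rewrite [RHS]addrA subrK.
  rewrite (le_trans (mnmD _ _))//.
  have h1 := mnmM (X (B - A)) (Y B); have h2 := mnmM (X A) (Y (B - A)).
  have h3 : mnm (X (B - A)) * mnm (Y B) <= mnm (A - B) * (1 / 8).
    apply: ler_pM; rewrite ?mnm_ge0 ?(mnmBC A) ?mnm_mask//.
    by rewrite (le_trans (mnm_mask _ _)).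
  have h4 : mnm (X A) * mnm (Y (B - A)) <= (1 / 8) * mnm (A - B).
    apply: ler_pM; rewrite ?mnm_ge0 ?(mnmBC A) ?mnm_mask//.
    by rewrite (le_trans (mnm_mask _ _)).
  lra.
have [z zr zE] := contraction_fixpoint Phi0 PhiC.
exists (X z), (Y z); split; try exact: msupp_mask.
- by rewrite (le_trans (mnm_mask _ _)).
- by rewrite (le_trans (mnm_mask _ _)).
have zXY : Y z + X z = z by exact: mmask_compl.
rewrite mulmxDl !mulmxDr !mul1mx mulmx1 -addrA; congr (_ + _).
by rewrite addrA zXY -{1}zE /Phi subrK.
Qed.

Definition dmx rho : M := diag_mx (\row_i mono R (rho i)).

Lemma mul_dmx rho A : dmx rho *m A = \matrix_(i, j) (mono R (rho i) * A i j).
Proof. by rewrite /dmx mul_diag_mx; apply/matrixP => i j; rewrite !mxE. Qed.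

Lemma mulmx_dmx rho A : A *m dmx rho = \matrix_(i, j) (A i j * mono R (rho j)).
Proof. by rewrite /dmx mul_mx_diag; apply/matrixP => i j; rewrite !mxE. Qed.

Lemma dmxN rho : dmx rho *m dmx (fun i => - rho i) = 1%:M.
Proof.
rewrite mul_dmx; apply/matrixP => i j; rewrite !mxE.
case: eqVneq => _; last by rewrite mulr0n mulr0.
by rewrite mulr1n -monoD subrr.
Qed.

Lemma dmxNr rho : dmx (fun i => - rho i) *m dmx rho = 1%:M.
Proof.
have := dmxN (fun i => - rho i); congr (_ *m dmx _ = _).
by apply: funext => i; rewrite opprK.
Qed.

Lemma mnm_dmx rho : mnm (dmx rho) = p%:R.
Proof.
rewrite /mnm -[in RHS](card_ord p) -sumr_const; apply: eq_bigr => i _.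
rewrite (bigD1 i)//= !mxE eqxx mulr1n wnm_mono big1 ?addr0// => j ji.
by rewrite !mxE eq_sym (negPf ji) mulr0n wnm0.
Qed.

Lemma wcoefM_mono (u : W) (m k : int) : (u * mono R m) k = u (k - m).
Proof.
rewrite mulrC wcoefM -(@csum_shift _ _ m) ?csum_supp0.
- by rewrite wcoef_mono add0r eqxx mul1r.
- by move=> j j0; rewrite wcoef_mono -subr_eq0 addrK (negPf j0) mul0r.
- exact: (l1_conv_col k (wcoef_l1 (mono R m)) (wcoef_l1 u)).
Qed.

(** Conjugation multiplies entry (i, j) by t^(sigma i - sigma j). *)
Lemma msupp_conj rho sigma A : msupp (plus_part rho) A ->
  msupp (plus_part (fun i => sigma i + rho i)) (dmx sigma *m A *m dmx (fun i => - sigma i)).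
Proof.
move=> sA i j k; rewrite /plus_part mulmx_dmx mul_dmx 2!mxE => k0.
rewrite wcoefM_mono mulrC wcoefM_mono sA// /plus_part; lia.
Qed.

End Supports.

Arguments minus_part {p}.

(** * Perturbation and uniqueness of factorisations *)

Section Perturbation.
Variables (R : realType) (p : nat).
Local Notation W := (wiener R).
Local Notation M := 'M[W]_p.
Implicit Types (A B : M) (rho : 'I_p -> int).

(** The plus algebra, seen as the case of zero exponents so that it inherits closure under
    products. *)
Definition plus0 : 'I_p -> 'I_p -> pred int := plus_part (fun=> 0).

Lemma msupp_conj_to rho A : msupp plus0 A ->
  msupp (plus_part rho) (dmx R rho *m A *m dmx R (fun i => - rho i)).
Proof.
move=> /(msupp_conj (sigma := rho)); apply: msuppW => i j k.
by rewrite /plus_part !addr0.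
Qed.

Lemma msupp_conj_from rho A : msupp (plus_part rho) A ->
  msupp plus0 (dmx R (fun i => - rho i) *m A *m dmx R rho).
Proof.
move=> /(msupp_conj (sigma := fun i => - rho i)).
have -> : (fun i => - - rho i) = rho by apply: funext => i; rewrite opprK.
by apply: msuppW => i j k; rewrite /plus0 /plus_part !addNr.
Qed.

(** [x] appears in the conclusion because its support later shows that the normalisation survives.
    The bounds involve the unperturbed inverse factors only, not [B]. *)
Lemma factorisation_perturbation rho Am Ami Ap Api B :
  (forall i j, rho i - rho j <= 1) ->
  msupp minus_part Ami -> Am *m Ami = 1%:M ->
  msupp plus0 Ap -> msupp plus0 Api -> Ap *m Api = 1%:M ->
  mnm (Ami *m (B - Am *m dmx R rho *m Ap) *m Api *m dmx R (fun i => - rho i)) <= 1 / 16 ->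
  exists x Bmi Bp Bpi : M,
    [/\ msupp (fun i j => predC (plus_part rho i j)) x,
        msupp minus_part Bmi /\ (Am *m (1%:M + x)) *m Bmi = 1%:M,
        [/\ msupp plus0 Bp, msupp plus0 Bpi & Bp *m Bpi = 1%:M],
        B = Am *m (1%:M + x) *m dmx R rho *m Bp
      & mnm Bmi <= 2 * p%:R * mnm Ami /\
        mnm Bpi <= mnm Api * p%:R * (2 * p%:R) * p%:R].
Proof.
move=> rho1 sAmi AmAmi sAp sApi ApApi; set e := _ *m dmx R (fun i => - rho i) => e16.
have [x [y [sx sy x8 y8 xyE]]] := small_factorisation (plus_part rho) e16.
(* Stability enters here: strictly below rho i - rho j <= 1 only nonpositive frequencies remain. *)
have sxm : msupp minus_part x.
  apply: msuppW sx => i j k; rewrite /minus_part /plus_part /= -ltNge.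
  by have := rho1 i j; lia.
have x4 : mnm x <= 1 / 4 by lra.
have y4 : mnm y <= 1 / 4 by lra.
have [vx [svx vx4 vxE]] := small_inverse (@msupp1_minus R p) (@msuppM_minus R p) sxm x4.
have [vy [svy vy4 vyE]] :=
  small_inverse (@msupp1_plus R p rho) (@msuppM_plus R p rho) sy y4.
set D := dmx R rho; set D' := dmx R (fun i => - rho i).
have DD' : D *m D' = 1%:M by exact: dmxN.
have D'D : D' *m D = 1%:M by exact: dmxNr.
(* [vx] and [vy] invert 1 + x and 1 + y. Conjugation by [D] returns the upper factors to the plus
   algebra. *)
exists x, (vx *m Ami), (D' *m (1%:M + y) *m D *m Ap), (Api *m (D' *m vy *m D)); split => //.
- split; first exact: msuppM_minus.
  by rewrite mulmxA -(mulmxA Am) vxE mulmx1.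
- split.
  + apply: msuppM_plus => //; apply: msupp_conj_from.
    by apply: msuppD => //; exact: msupp1_plus.
  + by apply: msuppM_plus => //; exact: msupp_conj_from.
  + rewrite mulmxA -(mulmxA _ Ap) ApApi mulmx1 !mulmxA.
    by rewrite -(mulmxA _ D) DD' mulmx1 -(mulmxA D') vyE mulmx1.
(* The product collapses to Am (1 + e) D Ap, and Am e D Ap = B - Am D Ap. *)
- rewrite !mulmxA -(mulmxA _ D D') DD' mulmx1 -(mulmxA Am) xyE.
  rewrite mulmxDr mulmx1 !mulmxDl /e !mulmxA AmAmi mul1mx -/D -/D'.
  rewrite -(mulmxA _ D' D) D'D mulmx1 -(mulmxA _ Api Ap) (mulmx1C ApApi) mulmx1.
  by rewrite addrC subrK.
split.
  by apply: le_trans (mnmM _ _) _; rewrite ler_wpM2r// mnm_ge0.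
apply: le_trans (mnmM _ _) _; rewrite -2!mulrA ler_wpM2l ?mnm_ge0//.
apply: le_trans (mnmM _ _) _; rewrite mnm_dmx mulrA ler_wpM2r//.
by apply: le_trans (mnmM _ _) _; rewrite mnm_dmx ler_wpM2l.
Qed.

Definition coef_mx A (k : int) : 'M[R[i]]_p := \matrix_(i, j) A i j k.

Lemma csum_box (f : int -> R[i]) n : (l1 f < +oo)%E ->
  (forall k : int, (n < absz k)%N -> f k = 0) -> csum f = psum f n.
Proof.
move=> foo f0; apply/eqP; rewrite -subr_eq0; apply/eqP/cabs0_eq0/eqP.
rewrite eq_le cabs_ge0 andbT -lee_fin; apply: le_trans (csum_tail n foo) _.
rewrite esum1// => k; rewrite /box /= => /negP; rewrite -ltnNge => /f0 ->.
by rewrite cabs0.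
Qed.

Lemma coef_mxM0 A B : msupp minus_part A -> msupp minus_part B ->
  coef_mx (A *m B) 0 = coef_mx A 0 *m coef_mx B 0.
Proof.
move=> sA sB; apply/matrixP => i j; rewrite !mxE wcoef_sum; apply: eq_bigr => l _.
rewrite !mxE wcoefM csum_supp0 ?subr0// => k k0.
have [kp|kn] := leP k 0; last by rewrite sA ?mul0r// /minus_part -ltNge.
by rewrite sB ?mulr0// /minus_part; lia.
Qed.

(** For minus factors the coefficients at 0 and -1 are the C_0 and C_1 of the expansion at infinity,
    and they multiply like power series in 1/t. *)
Lemma coef_mxMN1 A B : msupp minus_part A -> msupp minus_part B ->
  coef_mx (A *m B) (-1) = coef_mx A 0 *m coef_mx B (-1) + coef_mx A (-1) *m coef_mx B 0.
Proof.
move=> sA sB; apply/matrixP => i j; rewrite !mxE wcoef_sum -big_split.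
apply: eq_bigr => l _; rewrite !mxE wcoefM.
have A1 k : 0 < k -> A i l k = 0 by move=> k0; rewrite sA// /minus_part -ltNge.
have B1 k : 0 < k -> B l j k = 0 by move=> k0; rewrite sB// /minus_part -ltNge.
rewrite (@csum_box _ 1) ?psumS ?psum0.
- by rewrite subr0 subrr (A1 1%:Z)// mul0r addr0 addrC.
- exact: l1_conv_col (wcoef_l1 _) (wcoef_l1 _).
move=> k k1; have [kp|kn] := leP k 0; last by rewrite A1 ?mul0r.
by rewrite B1 ?mulr0//; lia.
Qed.

End Perturbation.

(** * Normalisation of 2 x 2 factors: invariance and uniqueness *)

Section Normalisation.
Variable R : realType.
Local Notation W := (wiener R).
Local Notation M := 'M[W]_2.
Implicit Types (A B : M) (P : 'M[R[i]]_2).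

Definition rho_fun (rho1 rho2 : int) (i : 'I_2) : int := if i == ord0 then rho1 else rho2.

Local Notation o1 := (lift ord0 ord0 : 'I_2).

Lemma rho_fun0 rho1 rho2 : rho_fun rho1 rho2 ord0 = rho1. Proof. by []. Qed.
Lemma rho_fun1 rho1 rho2 : rho_fun rho1 rho2 o1 = rho2. Proof. by []. Qed.

Lemma ord2P (Q : 'I_2 -> Prop) : Q ord0 -> Q o1 -> forall i, Q i.
Proof.
by move=> q0 q1 i; case: (unliftP ord0 i) => [j|] ->; rewrite ?(ord1 j).
Qed.

Lemma rho_fun_le1 rho1 rho2 : rho1 <= rho2 -> stable rho1 rho2 ->
  forall i j, rho_fun rho1 rho2 i - rho_fun rho1 rho2 j <= 1.
Proof.
rewrite /stable => h1 h2.
by apply: ord2P; apply: ord2P; rewrite ?rho_fun0 ?rho_fun1; lia.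
Qed.

Lemma mulmx2E (K : pzSemiRingType) (A B : 'M[K]_2) i j :
  (A *m B) i j = A i ord0 * B ord0 j + A i o1 * B o1 j.
Proof. by rewrite mxE !big_ord_recl big_ord0 addr0. Qed.

Lemma unit_ltP (C : 'M[R[i]]_2) :
  unit_lower_triangular C <-> [/\ C ord0 o1 = 0, C ord0 ord0 = 1 & C o1 o1 = 1].
Proof.
split=> [[/is_trig_mxP C0 C1]|[C01 C00 C11]]; first by split; rewrite ?C1// C0.
split; last by apply: ord2P.
by apply/is_trig_mxP; apply: ord2P; apply: ord2P.
Qed.

(** With equal indices [x] has no constant term. With rho2 = rho1 + 1 its constant term is confined
    to the lower left entry, so C_0 is multiplied by a unit lower triangular matrix, and its upper
    right entry starts at t^-2, which preserves the condition on C_1. [P] acts on the other side. *)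
Lemma normalised_mul P rho1 rho2 A x : rho1 <= rho2 -> stable rho1 rho2 ->
  msupp minus_part A ->
  msupp (fun i j => predC (plus_part (rho_fun rho1 rho2) i j)) x ->
  normalised P rho1 rho2 (coef_mx A) -> normalised P rho1 rho2 (coef_mx (A *m (1%:M + x))).
Proof.
move=> r12 st sA sx.
have x0 i j k : rho_fun rho1 rho2 i - rho_fun rho1 rho2 j <= k -> x i j k = 0.
  by move=> h; apply: sx; rewrite /= negbK.
have s1x : msupp minus_part (1%:M + x).
  apply: msuppD; first exact: msupp1_minus.
  apply: msuppW sx => i j k; rewrite /minus_part /plus_part /= -ltNge.
  by have := rho_fun_le1 r12 st i j; lia.
have c0 i j : coef_mx (1%:M + x) 0 i j = (i == j)%:R + x i j 0.
  by rewrite !mxE wcoefD; case: (i == j).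
have c1 i j : coef_mx (1%:M + x) (-1) i j = x i j (-1).
  by rewrite !mxE wcoefD; case: (i == j); rewrite ?wcoef1 ?wcoef0 add0r.
rewrite /normalised coef_mxM0// coef_mxMN1//; case: eqVneq => [rr|rne].
  move=> ->; rewrite mul1mx; apply/matrixP => i j; rewrite c0 x0 ?addr0 ?mxE//.
  by rewrite -rr /rho_fun !if_same subrr.
have r21 : rho2 = rho1 + 1 by move: st; rewrite /stable; lia.
move=> [/unit_ltP[C01 C00 C11] CN].
have x01 : x ord0 o1 0 = 0 by rewrite x0// rho_fun0 rho_fun1; lia.
have x01' : x ord0 o1 (-1) = 0 by rewrite x0// rho_fun0 rho_fun1; lia.
have x00 : x ord0 ord0 0 = 0 by rewrite x0// rho_fun0; lia.
have x11 : x o1 o1 0 = 0 by rewrite x0// rho_fun1; lia.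
split.
  apply/unit_ltP; rewrite mulmxA !(mulmx2E (P *m coef_mx A 0)) !c0 x01 x00 x11 C01 C00 C11.
  by split; rewrite ?(addr0, add0r, mul0r, mulr0, mulr1).
rewrite mulmxDr !mulmxA mxE (mulmx2E (P *m coef_mx A 0)) (mulmx2E (P *m coef_mx A (-1))).
by rewrite !c1 !c0 x01' x01 C01 CN !(addr0, mul0r, mulr0).
Qed.

(** The two supports of [u] meet in few frequencies. With equal indices only constants remain.
    Otherwise the diagonal is constant, the lower left entry is 0, and the upper right entry has
    frequencies -1 and 0 only; the normalisation fixes these four coefficients. *)
Lemma normalised_unique P rho1 rho2 A u : rho1 <= rho2 -> stable rho1 rho2 ->
  msupp minus_part A -> msupp minus_part u -> msupp (plus_part (rho_fun rho1 rho2)) u ->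
  normalised P rho1 rho2 (coef_mx A) -> normalised P rho1 rho2 (coef_mx (A *m u)) -> u = 1%:M.
Proof.
move=> r12 st sA sum sup.
have up i j k : 0 < k -> u i j k = 0 by move=> h; apply: sum; rewrite /minus_part -ltNge.
have un i j k : k < rho_fun rho1 rho2 i - rho_fun rho1 rho2 j -> u i j k = 0.
  by move=> h; apply: sup; rewrite /plus_part -ltNge.
rewrite /normalised coef_mxM0// coef_mxMN1//; case: eqVneq => [rr|rne].
  move=> ->; rewrite mul1mx => u0; apply/matrixP => i j; apply: wiener_ext => k.
  have [k0|k0|->] := ltgtP k 0.
  - rewrite un; last by rewrite -rr /rho_fun !if_same subrr.
    by rewrite mxE; case: (i == j); rewrite ?wcoef0// wcoef1 lt_eqF.
  - by rewrite up// mxE; case: (i == j); rewrite ?wcoef0// wcoef1 gt_eqF.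
  - have := congr1 (fun C : 'M[R[i]]_2 => C i j) u0; rewrite !mxE => ->.
    by case: (i == j).
have r21 : rho2 = rho1 + 1 by move: st; rewrite /stable; lia.
move=> [/unit_ltP[C01 C00 C11] CN] [/unit_ltP CD CDN]; move: CD.
rewrite mulmxA !(mulmx2E (P *m coef_mx A 0)) C01 C00 C11 !mxE.
rewrite !(mul0r, mul1r, addr0) => -[u01 u00].
rewrite u01 mulr0 add0r => u11.
move: CDN; rewrite mulmxDr !mulmxA mxE (mulmx2E (P *m coef_mx A 0)) (mulmx2E (P *m coef_mx A (-1))).
rewrite C01 C00 CN !mxE u01 u11 !(mul0r, mul1r, mulr0, addr0) => u01'.
suff uE : forall i j k, u i j k = (1%:M : M) i j k.
  by apply/matrixP => i j; apply: wiener_ext => k.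
have r1 (b : bool) (k : int) : ((b%:R : W) k) = (b && (k == 0))%:R.
  by case: b; rewrite ?wcoef1 ?wcoef0.
apply: ord2P; apply: ord2P => k; rewrite mxE r1 /=.
- have [k0|k0|->//] := ltgtP k 0; first by rewrite un// rho_fun0; lia.
  by rewrite up.
- have [->//|k1] := eqVneq k (-1); have [k0|k0|->//] := ltgtP k 0; last by rewrite up.
  by rewrite un// rho_fun0 rho_fun1; lia.
- have [k0|k0] := leP k 0; first by rewrite un// rho_fun0 rho_fun1; lia.
  by rewrite up.
- have [k0|k0|->//] := ltgtP k 0; first by rewrite un// rho_fun1; lia.
  by rewrite up.
Qed.

End Normalisation.

(** * Families of coefficients as elements of the Wiener algebra *)

Section Bridge.
Variables (R : realType) (p : nat).
Local Notation W := (wiener R).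
Local Notation M := 'M[W]_p.
Implicit Types (U V : M) (A : int -> 'M[R[i]]_p).

Lemma le_cabs_norm1 (C : 'M[R[i]]_p) i j : cabs (C i j) <= norm1 C.
Proof.
apply: (@le_trans _ _ (\sum_(i < p) cabs (C i j))).
  by rewrite (bigD1 i)//= lerDl sumr_ge0// => *; exact: cabs_ge0.
exact: (le_bigmax _ (fun j => \sum_(i < p) cabs (C i j))).
Qed.

Lemma norm1_le_sum (C : 'M[R[i]]_p) : norm1 C <= \sum_i \sum_j cabs (C i j).
Proof.
rewrite exchange_big; apply: bigmax_le => [|j _].
  by do 2!apply: sumr_ge0 => ? _; exact: cabs_ge0.
rewrite [leRHS](bigD1 j)//= lerDl.
by do 2!apply: sumr_ge0 => ? _; exact: cabs_ge0.
Qed.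

Lemma norm1_ge0 (C : 'M[R[i]]_p) : 0 <= norm1 C.
Proof. by rewrite /norm1; elim/big_rec: _ => // i x _ x0; rewrite le_max x0 orbT. Qed.

Lemma in_W_coef_mx A : in_W A -> exists U, A = coef_mx U.
Proof.
move=> AW; have l1A i j : (l1 (fun k => A k i j) < +oo)%E.
  by apply: le_lt_trans AW; apply: le_esum => k _; rewrite lee_fin le_cabs_norm1.
exists (\matrix_(i, j) Wiener (l1A i j)); apply: funext => k.
by apply/matrixP => i j; rewrite !mxE.
Qed.

Lemma wnorm_coef_mx U : (wnorm (coef_mx U) <= (mnm U)%:E)%E.
Proof.
apply: (@le_trans _ _ (\esum_(k in [set: int]) \sum_i \sum_j (cabs (U i j k))%:E)%E).
  apply: le_esum => k _; under eq_bigr do rewrite sumEFin.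
  rewrite sumEFin lee_fin (le_trans (norm1_le_sum _))//.
  by do 2!apply: ler_sum => ? _; rewrite mxE.
rewrite esum_sum => [|k i _ _]; last by apply: sume_ge0 => j _; exact: cabsE_ge0.
rewrite /mnm -sumEFin; apply: lee_sum => i _.
rewrite esum_sum => [|k j _ _]; last exact: cabsE_ge0.
by rewrite -sumEFin; apply: lee_sum => j _; rewrite wnmE.
Qed.

Lemma wnorm_ge0 A : (0 <= wnorm A)%E.
Proof. by apply: esum_ge0 => k _; rewrite lee_fin norm1_ge0. Qed.

Lemma in_W_of_coef_mx U : in_W (coef_mx U).
Proof. exact: le_lt_trans (wnorm_coef_mx U) (ltry _). Qed.

Lemma weval_coef_mx U (t : circle R) : weval (coef_mx U) t = map_mx (wev t) U.
Proof.
apply/matrixP => i j; rewrite !mxE /wev /fourier.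
rewrite -[LHS]/(csum (fun k => coef_mx U k i j * (t : R[i]) ^ k)).
by apply: eq_csum => k; rewrite mxE.
Qed.

Lemma map_wev_ext U V : (forall t, map_mx (wev t) U = map_mx (wev t) V) -> U = V.
Proof.
move=> UV; apply/matrixP => i j; apply: wev_ext => t.
by have /matrixP/(_ i j) := UV t; rewrite !mxE.
Qed.

(** The pointwise identity on the circle lifts to the matrix ring because Fourier series determine
    their coefficients. *)
Lemma is_winv_coef_mx U B : is_winv (coef_mx U) B <-> exists2 V, B = coef_mx V & U *m V = 1%:M.
Proof.
split=> [[/in_W_coef_mx[V ->] UV]|[V -> UV]].
  exists V => //; apply: map_wev_ext => t.
  by rewrite map_mxM map_mx1 -!weval_coef_mx UV//; exact: circleP.
split=> [|t t1]; first exact: in_W_of_coef_mx.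
by rewrite !(weval_coef_mx _ (Circle t1)) -map_mxM UV map_mx1.
Qed.

(** [xget] must return [V], since a right inverse over a commutative ring is two-sided and hence
    unique. *)
Lemma winv_coef_mx U V : U *m V = 1%:M -> winv (coef_mx U) = coef_mx V.
Proof.
move=> UV; apply: xget_unique => [|B /is_winv_coef_mx[V' -> UV']].
  by apply/is_winv_coef_mx; exists V.
by rewrite -[V']mul1mx -(mulmx1C UV) -mulmxA UV' mulmx1.
Qed.

Lemma in_Wplus_coef_mx U : in_Wplus (coef_mx U) <-> msupp (@plus0 p) U.
Proof.
split=> [[_ U0] i j k|sU]; last first.
  split=> [|k k0]; first exact: in_W_of_coef_mx.
  by apply/matrixP => i j; rewrite !mxE sU// /plus0 /plus_part subr0 -ltNge.
rewrite /plus0 /plus_part subr0 -ltNge => /U0/matrixP/(_ i j).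
by rewrite !mxE.
Qed.

Lemma in_Wminus_coef_mx U : in_Wminus (coef_mx U) <-> msupp minus_part U.
Proof.
split=> [[_ U0] i j k|sU]; last first.
  split=> [|k k0]; first exact: in_W_of_coef_mx.
  by apply/matrixP => i j; rewrite !mxE sU// /minus_part -ltNge.
rewrite /minus_part -ltNge => /U0/matrixP/(_ i j).
by rewrite !mxE.
Qed.

Lemma unit_Wplus_coef_mx A : unit_Wplus A <->
  exists U V, [/\ A = coef_mx U, msupp (@plus0 p) U, msupp (@plus0 p) V & U *m V = 1%:M].
Proof.
split=> [[AW [B [BW AB]]]|[U [V [-> sU sV UV]]]].
  have [U AU] := in_W_coef_mx AW.1; rewrite AU in AW AB *.
  have [V BV UV] := (is_winv_coef_mx U B).1 AB; rewrite BV in BW.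
  by exists U, V; split=> //; apply/in_Wplus_coef_mx.
split; first exact/in_Wplus_coef_mx.
by exists (coef_mx V); split; [exact/in_Wplus_coef_mx|apply/is_winv_coef_mx; exists V].
Qed.

Lemma unit_Wminus_coef_mx A : unit_Wminus A <->
  exists U V, [/\ A = coef_mx U, msupp minus_part U, msupp minus_part V & U *m V = 1%:M].
Proof.
split=> [[AW [B [BW AB]]]|[U [V [-> sU sV UV]]]].
  have [U AU] := in_W_coef_mx AW.1; rewrite AU in AW AB *.
  have [V BV UV] := (is_winv_coef_mx U B).1 AB; rewrite BV in BW.
  by exists U, V; split=> //; apply/in_Wminus_coef_mx.
split; first exact/in_Wminus_coef_mx.
by exists (coef_mx V); split; [exact/in_Wminus_coef_mx|apply/is_winv_coef_mx; exists V].
Qed.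

End Bridge.

(** * Normalised factorisations inside the matrix ring *)

Section Factorisation.
Variable R : realType.
Local Notation W := (wiener R).
Local Notation M := 'M[W]_2.
Implicit Types (A B : M) (P : 'M[R[i]]_2).

(** Counterpart of [stable_normalised_factorisation] with the inverse factors as explicit data,
    since they are what must be bounded. *)
Record wfact P (rho1 rho2 : int) A (Am Ami Ap Api : M) : Prop := WFact {
  wf_le : rho1 <= rho2;
  wf_stable : stable rho1 rho2;
  wf_norm : normalised P rho1 rho2 (coef_mx Am);
  wf_m : msupp minus_part Am;
  wf_mi : msupp minus_part Ami;
  wf_p : msupp (@plus0 2) Ap;
  wf_pi : msupp (@plus0 2) Api;
  wf_mV : Am *m Ami = 1%:M;
  wf_pV : Ap *m Api = 1%:M;
  wf_eq : A = Am *m dmx R (rho_fun rho1 rho2) *m Ap }.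

Lemma map_dmx rho1 rho2 (t : circle R) :
  map_mx (wev t) (dmx R (rho_fun rho1 rho2)) = d_r rho1 rho2 t.
Proof.
apply/matrixP; apply: ord2P; apply: ord2P; rewrite !mxE /=.
all: by rewrite ?mulr1n ?mulr0n ?wev_mono ?rmorph0.
Qed.

Lemma wfactP P (a : R[i] -> 'M[R[i]]_2) rho1 rho2 A am ap :
  (forall t : circle R, a t = map_mx (wev t) A) ->
  stable_normalised_factorisation P a am rho1 rho2 ap <->
  exists Am Ami Ap Api, [/\ am = coef_mx Am, ap = coef_mx Ap & wfact P rho1 rho2 A Am Ami Ap Api].
Proof.
move=> aA; split=> [[[r12 /unit_Wminus_coef_mx[Am [Ami [-> sm smi mV]]]
    /unit_Wplus_coef_mx[Ap [Api [-> sp spi pV]]] aE] st nrm]|].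
  exists Am, Ami, Ap, Api; split=> //; split=> //.
  apply: map_wev_ext => t; rewrite -aA aE; last exact: circleP.
  by rewrite !map_mxM map_dmx !weval_coef_mx.
move=> [Am [Ami [Ap [Api [-> -> []]]]]] r12 st nrm sm smi sp spi mV pV AE.
split=> //; split=> // [||t t1].
- by apply/unit_Wminus_coef_mx; exists Am, Ami.
- by apply/unit_Wplus_coef_mx; exists Ap, Api.
rewrite -[t]/(circle_val (Circle t1)) aA AE !map_mxM map_dmx.
by rewrite !weval_coef_mx.
Qed.

(** Equating the two products gives Am^-1 Bm = D (Ap Bp^-1) D^-1. The left side is in the minus
    algebra and the right side in the conjugated plus algebra, so [normalised_unique] makes both
    equal to 1. *)
Lemma wfact_unique P rho1 rho2 A Am Ami Ap Api Bm Bmi Bp Bpi :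
  wfact P rho1 rho2 A Am Ami Ap Api -> wfact P rho1 rho2 A Bm Bmi Bp Bpi ->
  Am = Bm /\ Ap = Bp.
Proof.
move=> [r12 st nA sm smi sp spi mV pV AE] [_ _ nB sm' smi' sp' spi' mV' pV' AE'].
pose u := Ami *m Bm; set D := dmx R (rho_fun rho1 rho2) in AE AE'.
pose D' := dmx R (fun i => - rho_fun rho1 rho2 i).
have DD' : D *m D' = 1%:M by exact: dmxN.
have D'D : D' *m D = 1%:M by exact: dmxNr.
have BmE : Bm = Am *m u by rewrite /u mulmxA mV mul1mx.
have uE : u = D *m (Ap *m Bpi) *m D'.
  have : Ami *m (Am *m D *m Ap) *m Bpi *m D' = Ami *m (Bm *m D *m Bp) *m Bpi *m D'.
    by rewrite -AE -AE'.
  rewrite !mulmxA (mulmx1C mV) mul1mx -!mulmxA (mulmxA Bp) pV' mul1mx DD' mulmx1.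
  by rewrite /u => <-.
have u1 : u = 1%:M.
  apply: (@normalised_unique _ P rho1 rho2 Am) => //; last by rewrite -BmE.
    exact: msuppM_minus.
  by rewrite uE; apply: msupp_conj_to; exact: msuppM_plus.
split; first by rewrite BmE u1 mulmx1.
have ApBpi : Ap *m Bpi = 1%:M.
  have : D' *m u *m D = Ap *m Bpi.
    by rewrite uE !mulmxA D'D mul1mx -mulmxA D'D mulmx1.
  by rewrite u1 mulmx1 D'D.
by rewrite -[Ap]mulmx1 -(mulmx1C pV') mulmxA ApBpi mul1mx.
Qed.

End Factorisation.

(** * The symbols a and a_N *)

Section Symbols.
Variable R : realType.
Local Notation W := (wiener R).
Implicit Types (alpha beta c : nat -> R[i]).

(** From some index on, a term is the difference of two partial sums within 1 of the limit, whence
    the 2; the sum of moduli covers the earlier terms. *)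
Lemma convergent_sum_terms_bounded c (l : R[i]) :
  (fun n => \sum_(0 <= k < n.+1) c k : R[i]^o) @ \oo --> (l : R[i]^o) ->
  exists2 C : R, 0 <= C & forall n, cabs (c n) <= C.
Proof.
move=> /cvg_cabsP/(_ 1 ltr01)[N0 _ N0P].
have s0 : 0 <= \sum_(i < N0.+1) cabs (c i) by apply: sumr_ge0 => i _; exact: cabs_ge0.
exists (2 + \sum_(i < N0.+1) cabs (c i)) => [|n]; first by lra.
have [nN|] := ltnP n N0.+1.
  apply: (@le_trans _ _ (\sum_(i < N0.+1) cabs (c i))); last by lra.
  rewrite (bigD1 (Ordinal nN))//= lerDl.
  by apply: sumr_ge0 => i _; exact: cabs_ge0.
case: n => // m mN; have h1 := N0P m mN; have h2 := N0P m.+1 (leqW mN).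
rewrite /= big_nat_recr//= in h2; set S := \sum_(0 <= i < m.+1) c i in h1 h2.
have -> : c m.+1 = (l - S) - (l - (S + c m.+1)) by ring.
by apply: le_trans (cabsD _ _) _; rewrite cabsN; lra.
Qed.

Definition pos_coef c (k : int) : R[i] := if k is Posz n then c n else 0.
Definition neg_coef c (k : int) : R[i] := if k is Negz n then c n.+1 else 0.

(** Abel's argument: convergence at a radius x with 1 < x < r2 bounds the terms there, so the
    coefficients are O(x^-n). *)
Lemma l1_pos_coef alpha alphap (r2 : \bar R) : (1%:E < r2)%E ->
  analytic_inside r2 alpha alphap -> (l1 (pos_coef alpha) < +oo)%E.
Proof.
move=> hr2 ha; have [x x1 xr2] : exists2 x : R, 1 < x & (x%:E < r2)%E.
  case: r2 hr2 {ha} => [r||//]; last by exists 2; rewrite ?ltry// ltr1n.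
  by rewrite lte_fin => r1; exists ((1 + r) / 2); rewrite ?lte_fin; lra.
have x0 : 0 < x by lra.
have cx : cabs (x%:C)%C = x by rewrite cabs_real gtr0_norm.
have [|C C0 CP] := @convergent_sum_terms_bounded
    (fun k => alpha k * (x%:C)%C ^+ k) (alphap (x%:C)%C).
  by apply: ha; rewrite cx.
apply: le_lt_trans (@esum_geo _ _ C x^-1 _ _ _ _ _) (ltry _) => //.
- exact: cabsE_ge0.
- by case=> // n; rewrite /pos_coef cabs0.
- by rewrite invr_ge0 ltW//= invf_lt1.
move=> n; rewrite lee_fin /= exprVn ler_pdivlMr ?exprn_gt0//.
by have := CP n; rewrite cabsM cabsX cx.
Qed.

Lemma l1_neg_coef beta betam (r1 : R) : 0 <= r1 < 1 ->
  analytic_outside r1 beta betam -> (l1 (neg_coef beta) < +oo)%E.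
Proof.
move=> hr1 hb; pose x := (1 + r1) / 2.
have x0 : 0 < x by rewrite /x; lra.
have x1 : x < 1 by rewrite /x; lra.
have xr1 : r1 < x by rewrite /x; lra.
have cx : cabs (x%:C)%C = x by rewrite cabs_real gtr0_norm.
(* The term at 0 is set to 0 because [beta_trunc] starts at k = 1. *)
pose c k := if k is 0%N then 0 else beta k * (x%:C)%C ^- k.
have [|C C0 CP] := @convergent_sum_terms_bounded c (betam (x%:C)%C).
  rewrite (_ : (fun n => _) = (fun n => beta_trunc beta n (x%:C)%C)).
    by apply: hb; rewrite cx.
  apply: funext => n; rewrite big_ltn// add0r; apply: eq_big_nat => k.
  by case: k.
(* Reflection of the indices, as [esum_geo] concerns families vanishing at negative indices. *)
have -> : l1 (neg_coef beta) = l1 (fun k => neg_coef beta (- k)).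
  by rewrite /l1 [LHS](reindex_esum [set: int] [set: int] (fun k : int => - k)).
apply: le_lt_trans (@esum_geo _ _ C x _ _ _ _ _) (ltry _) => //.
- by move=> k; rewrite lee_fin cabs_ge0.
- by case=> // n _; exact: (congr1 EFin (cabs0 R)).
- by rewrite ltW.
move=> n; rewrite lee_fin; case: n => [|n].
  have -> : neg_coef beta (- 0%N%:Z) = 0 by [].
  by rewrite cabs0 mulr_ge0// exprn_ge0// ltW.
rewrite -NegzE /=; have := CP n.+1; rewrite /c cabsM cabsV cabsX cx.
by rewrite ler_pdivrMr ?exprn_gt0.
Qed.

Lemma psum_neg (V : nmodType) (f : int -> V) n : (forall k : int, 0 <= k -> f k = 0) ->
  psum f n = \sum_(1 <= m < n.+1) f (- m%:Z).
Proof.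
move=> f0; elim: n => [|n IH]; first by rewrite psum0 big_geq// f0.
by rewrite psumS IH (f0 n.+1%:Z)// addr0 [RHS]big_nat_recr//= addrC.
Qed.

Lemma psum_pos_coef alpha (t : R[i]) n :
  psum (fun k => pos_coef alpha k * t ^ k) n = alpha_trunc alpha n t.
Proof.
rewrite psum_nat; last by case=> // m _; rewrite mul0r.
by rewrite /alpha_trunc big_mkord.
Qed.

Lemma psum_neg_coef beta (t : R[i]) n :
  psum (fun k => neg_coef beta k * t ^ k) n = beta_trunc beta n t.
Proof.
rewrite psum_neg; last by case=> // m _; rewrite mul0r.
by apply: eq_big_nat => -[//|m] _; rewrite -exprnN -NegzE.
Qed.

(** One symmetric truncation serves both symbols: it gives [alpha_trunc] on [pos_coef] and
    [beta_trunc] on [neg_coef]. *)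
Definition trunc (n : nat) (u : W) : W := wmask (fun k : int => (absz k <= n)%N) u.

Lemma wev_trunc n (u : W) (t : circle R) :
  wev t (trunc n u) = psum (fun k => u k * (t : R[i]) ^ k) n.
Proof.
rewrite /wev /fourier (@csum_box _ _ n).
- apply: eq_bigr => m _; rewrite wmaskE ifT//; have := ltn_ord m; lia.
- rewrite l1_twist; [exact: wcoef_l1|exact: circleP].
- by move=> k nk; rewrite wmaskE leqNgt nk mul0r.
Qed.

Lemma trunc_cvg (u : W) (e : R) : 0 < e -> \forall n \near \oo, wnm (u - trunc n u) < e.
Proof.
move=> e0; apply: filterS (wnm_tail_cvg u e0) => n; apply: le_lt_trans.
apply: le_wnm => k; rewrite wcoefB !wmaskE ltnNge.
by case: ifP => _; rewrite ?subrr ?subr0 ?cabs0.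
Qed.

Definition symbol (theta : int) (a b : W) : 'M[W]_2 :=
  mx2 1 b a (mono R theta + a * b).

Lemma map_symbol theta (a b : W) (f g : R[i] -> R[i]) (t : circle R) :
  wev t a = f t -> wev t b = g t -> a_mx theta f g t = map_mx (wev t) (symbol theta a b).
Proof.
move=> af bg; apply/matrixP; apply: ord2P; apply: ord2P; rewrite !mxE /=.
all: by rewrite ?rmorph1 ?rmorphD ?rmorphM /= ?wev_mono ?af ?bg.
Qed.

Lemma mnm2E (A : 'M[W]_2) : mnm A = (wnm (A ord0 ord0) + wnm (A ord0 (lift ord0 ord0))) +
  (wnm (A (lift ord0 ord0) ord0) + wnm (A (lift ord0 ord0) (lift ord0 ord0))).
Proof. by rewrite /mnm !big_ord_recl !big_ord0 !addr0. Qed.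

(** Only the lower right entry is nonlinear; there t^theta cancels and a b - a' b' = (a - a') b' + a
    (b - b'). *)
Lemma symbol_dist theta (a b a' b' : W) :
  mnm (symbol theta a' b' - symbol theta a b) <=
  wnm (b - b') + wnm (a - a') + (wnm (a - a') * wnm b' + wnm a * wnm (b - b')).
Proof.
have wnmBC (u v : W) : wnm (u - v) = wnm (v - u) by rewrite -wnmN opprB.
have h : wnm (mono R theta + a' * b' - (mono R theta + a * b)) <=
    wnm (a - a') * wnm b' + wnm a * wnm (b - b').
  have -> : mono R theta + a' * b' - (mono R theta + a * b) =
    - ((a - a') * b' + a * (b - b')) by ring.
  by rewrite wnmN (le_trans (wnmD _ _))// lerD// wnmM.
rewrite mnm2E !mxE /= subrr wnm0 (wnmBC b') (wnmBC a'); lra.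
Qed.

Lemma symbol_trunc_cvg theta (a b : W) (e : R) : 0 < e ->
  \forall n \near \oo,
    mnm (symbol theta (trunc n a) (trunc n b) - symbol theta a b) < e.
Proof.
(* Errors below e / K in both symbols make the bound of [symbol_dist] less than (e / K) (2 + |a| +
   |b|) = e. *)
move=> e0; pose K := 2 + wnm a + wnm b.
have K0 : 0 < K by have := wnm_ge0 a; have := wnm_ge0 b; rewrite /K; lra.
have eK : 0 < e / K by rewrite divr_gt0.
apply: filterS2 (trunc_cvg a eK) (trunc_cvg b eK) => n an bn.
apply: le_lt_trans (symbol_dist _ _ _ _ _) _.
have tb : wnm (trunc n b) <= wnm b by exact: wnm_mask.
have eE : e / K * K = e by rewrite divfK// gt_eqF.
have h1 : wnm (a - trunc n a) * wnm (trunc n b) <= e / K * wnm b.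
  by apply: ler_pM; rewrite ?wnm_ge0// ltW.
have h2 : wnm a * wnm (b - trunc n b) <= wnm a * (e / K).
  by rewrite ler_wpM2l ?wnm_ge0// ltW.
by move: eE; rewrite {2}/K; lra.
Qed.

End Symbols.

(** * Decay of [delta_N], stability under perturbation, and the theorem *)

Lemma delta_N_cvg (R : realType) (r1 : R) (r2 : \bar R)
    (alphap betam : R[i] -> R[i]) (z1 z2 e : R) :
  0 <= r1 < 1 -> (1%:E < r2)%E -> admissible r1 r2 alphap betam z1 z2 -> 0 < e ->
  \forall n \near \oo, `|delta_N r1 r2 alphap betam n z1 z2| < e.
Proof.
move=> hr1 hr2 [hz1 hz2] e0.
have z1b : 0 <= z1 < 1 by case: hz1 => [|[-> _ _]]; lra.
have z2b : 1 < z2 by case: hz2 => [[]//|[z2r _]]; rewrite -lte_fin z2r.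
rewrite /delta_N; set Mp := M_plus _ _ _; set Mm := M_minus _ _ _.
(* For a fixed pair, [delta_N] is c1 z1^n + c2 z2^-n; one factor of z1^(n+1) is absorbed in [c1]. *)
pose c1 := (1 + z2 * Mp / (z2 - 1)) * (z1 * Mm / (1 - z1)).
pose c2 := (1 + z1 * Mm / (1 - z1)) * (Mp / (z2 - 1)).
have cv : (fun n => c1 * z1 ^+ n + c2 * z2^-1 ^+ n) @ \oo --> c1 * 0 + c2 * 0.
  apply: cvgD; apply: cvgMr; apply: cvg_expr.
    by rewrite ger0_norm; lra.
  by rewrite normfV gtr0_norm ?invf_lt1; lra.
rewrite !mulr0 addr0 in cv.
have /cvgrPdist_lt/(_ e e0) := cv; apply: filterS => n.
rewrite sub0r normrN; congr (`|_| < e); rewrite /c1 /c2 exprVn exprS.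
have h1 : 1 - z1 != 0 by rewrite gt_eqF; lra.
have h2 : z2 - 1 != 0 by rewrite gt_eqF; lra.
have h3 : z2 != 0 by rewrite gt_eqF; lra.
by field; rewrite ?expf_neq0 ?h1 ?h2 ?h3.
Qed.

(** The bounds hold uniformly for [B] near [A]. The constants 4 and 16 are 2 p and p (2 p) p for p =
    2. *)
Lemma wfact_stable (R : realType) (P : 'M[R[i]]_2) rho1 rho2 A Am Ami Ap Api :
  wfact P rho1 rho2 A Am Ami Ap Api ->
  exists2 e : R, 0 < e & forall B, mnm (B - A) < e ->
    exists Bm Bmi Bp Bpi, wfact P rho1 rho2 B Bm Bmi Bp Bpi /\
      (mnm Bmi <= 4 * mnm Ami /\ mnm Bpi <= 16 * mnm Api).
Proof.
move=> [r12 st nA sm smi sp spi mV pV ->].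
(* The factor 2 is the norm of d^-1. *)
pose K := mnm Ami * mnm Api * 2.
have K0 : 0 <= K by rewrite !mulr_ge0 ?mnm_ge0.
(* Chosen so that K times the distance stays below 1/16; the + 1 keeps the denominator positive. *)
exists (1 / (16 * (K + 1))) => [|B BA]; first by rewrite divr_gt0//; lra.
have [|x [Bmi [Bp [Bpi [sx [sBmi mVB] [sBp sBpi pVB] BE [nBmi nBpi]]]]]] :=
    factorisation_perturbation (B := B) (rho_fun_le1 r12 st) smi mV sp spi pV.
  set C := B - _ in BA *.
  have bnd : mnm (Ami *m C *m Api *m dmx R (fun i => - rho_fun rho1 rho2 i)) <= K * mnm C.
    apply: le_trans (mnmM _ _) _; rewrite mnm_dmx.
    have -> : K * mnm C = mnm Ami * mnm C * mnm Api * 2 by rewrite /K; ring.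
    rewrite ler_wpM2r// (le_trans (mnmM _ _))// ler_wpM2r ?mnm_ge0//.
    exact: mnmM.
  apply: le_trans bnd _.
  have hK : (K + 1) * (1 / (16 * (K + 1))) = 1 / 16 by field; rewrite gt_eqF//; lra.
  rewrite -hK; apply: ler_pM; rewrite ?mnm_ge0 ?(ltW BA)//; lra.
exists (Am *m (1%:M + x)), Bmi, Bp, Bpi; split; last first.
  by split; [move: nBmi|move: nBpi]; lra.
split => //; first exact: normalised_mul.
apply: msuppM_minus => //; apply: msuppD; first exact: msupp1_minus.
apply: msuppW sx => i j k; rewrite /minus_part /plus_part /= -ltNge.
by have := rho_fun_le1 r12 st i j; lia.
Qed.

Theorem theorem4p1 (R : realType) (theta : int) (r1 : R) (r2 : \bar R)
    (alpha beta : nat -> R[i]) (alphap betam : R[i] -> R[i])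
    (P : 'M[R[i]]_2) (rho1 rho2 : int) (am ap : int -> 'M[R[i]]_2)
    (hr1 : 0 <= r1 < 1) (hr2 : (1%:E < r2)%E)
    (halpha : analytic_inside r2 alpha alphap)
    (hbeta : analytic_outside r1 beta betam)
    (hP : P = 1%:M \/ P = J2 R)
    (ha : stable_normalised_factorisation P (a_mx theta alphap betam)
            am rho1 rho2 ap) :
  exists N0 : nat,
    (forall N : nat, (N0 < N)%N ->
       exists amN apN : int -> 'M[R[i]]_2,
         stable_normalised_factorisation P (a_N theta alpha beta N)
           amN rho1 rho2 apN) /\
    (forall z1 z2 : R, admissible r1 r2 alphap betam z1 z2 ->
       exists N1 : nat, forall N : nat, (N1 < N)%N ->
         forall amN apN : int -> 'M[R[i]]_2,
           stable_normalised_factorisation P (a_N theta alpha beta N)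
             amN rho1 rho2 apN ->
           (q_N theta r1 r2 alphap betam N amN apN z1 z2 < 1%:E)%E).
Proof.
pose a := Wiener (l1_pos_coef hr2 halpha); pose b := Wiener (l1_neg_coef hr1 hbeta).
pose A := symbol theta a b; pose AN n := symbol theta (trunc n a) (trunc n b).
have aA (t : circle R) : a_mx theta alphap betam t = map_mx (wev t) A.
  apply: map_symbol.
    (* The partial sums of the Fourier series are the truncations, whose limit is known because |t|
       = 1 lies in the region of analyticity. *)
    have -> : wev t a = limn (fun n => alpha_trunc alpha n t : R[i]^o).
      have <- // : (fun n => psum (fun k => pos_coef alpha k * (t : R[i]) ^ k) n) =
        (fun n => alpha_trunc alpha n t) by apply: funext => n; exact: psum_pos_coef.
    apply: limn_cabs; apply/cvg_cabsP.
    by apply: (halpha _); rewrite circleP.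
  have -> : wev t b = limn (fun n => beta_trunc beta n t : R[i]^o).
    have <- // : (fun n => psum (fun k => neg_coef beta k * (t : R[i]) ^ k) n) =
        (fun n => beta_trunc beta n t) by apply: funext => n; exact: psum_neg_coef.
  apply: limn_cabs; apply/cvg_cabsP.
  by apply: (hbeta _); rewrite circleP; have /andP[] := hr1.
have aAN n (t : circle R) : a_N theta alpha beta n t = map_mx (wev t) (AN n).
  by apply: map_symbol; rewrite wev_trunc ?psum_pos_coef ?psum_neg_coef.
have [Am [Ami [Ap [Api [_ _ Afact]]]]] := (wfactP P rho1 rho2 am ap aA).1 ha.
have [e e0 eP] := wfact_stable Afact.
have [N0 _ N0P] := symbol_trunc_cvg theta a b e0.
have ANfact n : (N0 < n)%N -> exists Bm Bmi Bp Bpi,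
    wfact P rho1 rho2 (AN n) Bm Bmi Bp Bpi /\
    (mnm Bmi <= 4 * mnm Ami /\ mnm Bpi <= 16 * mnm Api).
  by move=> N0n; apply: eP; apply: N0P; exact: ltnW.
exists N0; split=> [n N0n|z1 z2 adm].
  have [Bm [Bmi [Bp [Bpi [Bfact _]]]]] := ANfact n N0n.
  exists (coef_mx Bm), (coef_mx Bp); apply/(wfactP P rho1 rho2 _ _ (aAN n)).
  by exists Bm, Bmi, Bp, Bpi.
(* Bounds sigma <= 2 times the norms of the two inverse factors, independently of n. *)
pose K := 2 * (16 * mnm Api) * (4 * mnm Ami).
have K0 : 0 <= K by rewrite !mulr_ge0 ?mnm_ge0.
have K1 : 0 < 1 / (K + 1) by rewrite divr_gt0//; lra.
have [N1 _ N1P] := delta_N_cvg hr1 hr2 adm K1.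
(* [N0] secures the bounded factorisation and [N1] the decay of [delta_N]; [N1] depends on the pair,
   as the rates z1^n and z2^-n do. *)
exists (maxn N0 N1) => n; rewrite gtn_max => /andP[N0n N1n] amN apN.
move=> /(wfactP P rho1 rho2 _ _ (aAN n))[Cm [Cmi [Cp [Cpi [-> -> Cfact]]]]].
have [Bm [Bmi [Bp [Bpi [Bfact [nBmi nBpi]]]]]] := ANfact n N0n.
(* The given factorisation is arbitrary; uniqueness identifies it with the one whose inverse factors
   are bounded. *)
have [-> ->] := wfact_unique Cfact Bfact.
rewrite /q_N (winv_coef_mx (wf_mV Bfact)) (winv_coef_mx (wf_pV Bfact)).
have wfin (U : 'M[wiener R]_2) : exists2 w : R, wnorm (coef_mx U) = w%:E & 0 <= w <= mnm U.
  have Ufin : wnorm (coef_mx U) \is a fin_num.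
    by rewrite ge0_fin_numE ?wnorm_ge0//; exact: in_W_of_coef_mx.
  exists (fine (wnorm (coef_mx U))); first by rewrite fineK.
  by rewrite fine_ge0 ?wnorm_ge0//= -lee_fin fineK//; exact: wnorm_coef_mx.
have [wp -> /andP[wp0 wpB]] := wfin Bpi; have [wm -> /andP[wm0 wmB]] := wfin Bmi.
have := N1P n (ltnW N1n); set d := delta_N _ _ _ _ _ _ _ => dlt.
(* Passing to absolute values avoids discussing the sign of [delta_N]. *)
rewrite -!EFinM lte_fin; apply: le_lt_trans (ler_norm _) _.
have s2 : `|sigma R theta| <= 2.
  by rewrite /sigma; case: ifP => _; rewrite ger0_norm// ler1n.
have bnd : `|sigma R theta * d * wp * wm| <= `|d| * K.
  rewrite !normrM (ger0_norm wp0) (ger0_norm wm0).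
  have -> : `|d| * K = 2 * `|d| * (16 * mnm Api) * (4 * mnm Ami) by rewrite /K; ring.
  apply: ler_pM; rewrite ?mulr_ge0//; last exact: le_trans nBmi.
  apply: ler_pM; rewrite ?mulr_ge0//; last exact: le_trans nBpi.
  by rewrite ler_wpM2r.
apply: le_lt_trans bnd _.
apply: (@le_lt_trans _ _ (1 / (K + 1) * K)); first by rewrite ler_wpM2r// ltW.
by rewrite mul1r mulrC ltr_pdivrMr ?mul1r; lra.
Qed.
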